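(* Let $d\ge 2$ and let $C_\psi$ be a $d$-dimensional Archimedean copula with generator $\psi$ and pseudoinverse $\varphi$. Let $\ell\in\{1,\ldots,d-1\}$. For $\mathbf{x}\in\mathbb{I}^\ell$ and $\mathbf{y}\in\mathbb{I}^{d-\ell}$, setting $$K_\psi(\mathbf{x},[\mathbf{0},\mathbf{y}])=\begin{cases}1 & \text{if } \min(\mathbf{x})=1 \text{ or } \mathbf{x}\in L_0^{1:\ell},\\ 0 & \text{if } \min(\mathbf{x})\in(0,1),\ \mathbf{x}\notin L_0^{1:\ell},\ (\mathbf{x},\mathbf{y})\in\mathrm{int}\,L_0,\\ \dfrac{\psi^{(\ell)}\left(\sum_{i=1}^{\ell}\varphi(x_i)+\sum_{j=1}^{d-\ell}\varphi(y_j)\right)}{\psi^{(\ell)}\left(\sum_{i=1}^{\ell}\varphi(x_i)\right)} & \text{if } \min(\mathbf{x})\in(0,1),\ \mathbf{x}\notin L_0^{1:\ell},\ (\mathbf{x},\mathbf{y})\notin\mathrm{int}\,L_0\end{cases}$$ yields (a version of) the $\ell$-Markov kernel of $C_\psi$.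
   Context: Notation: $\mathbb{I}=[0,1]$, $[\mathbf{0},\mathbf{y}]=[0,y_1]\times\cdots\times[0,y_{d-\ell}]$. Archimedean copulas: a generator is a continuous, non-increasing function $\psi:[0,\infty)\to\mathbb{I}$ with $\psi(0)=1$, $\lim_{z\to\infty}\psi(z)=0$, strictly decreasing on $[0,\inf\{z\in[0,\infty]:\psi(z)=0\}]$ (with $\psi(\infty):=0$). $\varphi:(0,1]\to[0,\infty)$ denotes the pseudoinverse of $\psi$, and $\varphi(0):=\inf\{z\in[0,\infty]:\psi(z)=0\}\in(0,\infty]$. A $d$-dimensional copula $C$ is Archimedean with generator $\psi$ if $C(\mathbf{x})=\psi(\varphi(x_1)+\cdots+\varphi(x_d))$ for all $\mathbf{x}\in\mathbb{I}^d$. The right-hand side is a copula if and only if $\psi$ is $d$-monotone: $\psi$ is continuous on $[0,\infty)$, has derivatives $\psi^{(m)}$ up to order $d-2$ on $(0,\infty)$ with $(-1)^m\psi^{(m)}\ge0$ for $m=0,\ldots,d-2$, and $(-1)^{d-2}\psi^{(d-2)}$ is non-increasing and convex on $(0,\infty)$. Generators are normalized so that $\psi(1)=\frac12$. Convention: for $\ell=d-1$, $\psi^{(\ell)}$ is to be read as the left-hand derivative $D^-\psi^{(d-2)}$; moreover $\psi^{(\ell)}(\infty):=0$. Zero sets: $L_0=\{(\mathbf{x},\mathbf{y})\in\mathbb{I}^\ell\times\mathbb{I}^{d-\ell}: C_\psi(\mathbf{x},\mathbf{y})=0\}=\{(\mathbf{x},\mathbf{y}):\sum_{i=1}^\ell\varphi(x_i)+\sum_{j=1}^{d-\ell}\varphi(y_j)\ge\varphi(0)\}$,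 and $L_0^{1:\ell}\subseteq\mathbb{I}^\ell$ is defined analogously for the marginal copula $C_\psi^{1:\ell}(\mathbf{x})=C_\psi(\mathbf{x},1,\ldots,1)$. $\mathrm{int}\,L_0$ is the interior of $L_0$ and $(\mathbf{x},\mathbf{y})\in\mathrm{int}\,L_0$ if and only if $\sum_{i=1}^\ell\varphi(x_i)+\sum_{j=1}^{d-\ell}\varphi(y_j)>\varphi(0)$ (so $\mathrm{int}\,L_0$ is empty if $\varphi(0)=\infty$). Markov kernels: the $\ell$-Markov kernel of a copula $C$ is (a version of) the regular conditional distribution of $(X_{\ell+1},\ldots,X_d)$ given $(X_1,\ldots,X_\ell)$, where $(X_1,\ldots,X_d)\sim C$. Equivalently, it is a map $K:\mathbb{I}^\ell\times\mathcal{B}(\mathbb{I}^{d-\ell})\to\mathbb{I}$, measurable in the first argument and a probability measure in the second, with $\int_{[\mathbf{0},\mathbf{x}]}K(\mathbf{s},[\mathbf{0},\mathbf{y}])\,\mathrm{d}\mu_{C^{1:\ell}}(\mathbf{s})=C(\mathbf{x},\mathbf{y})$ for all $(\mathbf{x},\mathbf{y})\in\mathbb{I}^\ell\times\mathbb{I}^{d-\ell}$, where $\mu_{C^{1:\ell}}$ is the probability measure on $\mathbb{I}^\ell$ induced by $C^{1:\ell}$ (for $\ell=1$ this is Lebesgue measure). The displayed values on rectangles $[\mathbf{0},\mathbf{y}]$ determine the probability measure $K_\psi(\mathbf{x},\cdot)$. *)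

(* Defs.v *)
From HB Require Import structures.
From mathcomp Require Import all_boot all_order all_algebra.
From mathcomp Require Import all_classical all_reals all_analysis.
Set Implicit Arguments.
Unset Strict Implicit.
Unset Printing Implicit Defensive.
Import Order.TTheory GRing.Theory Num.Theory.
Import numFieldNormedType.Exports.
Local Open Scope classical_set_scope.
Local Open Scope ring_scope.

(* Points of R^n are n-tuples (which carry the product Borel sigma-algebra);
   copulas are functions on all of R^n of which only the values on the unit
   cube matter. *)

Definition unit_cube (R : realType) (n : nat) : set (n.-tuple R) :=
  [set x | forall i, 0 <= tnth x i <= 1].
Arguments unit_cube {R} n.

Definition box0 (R : realType) (n : nat) (x : n.-tuple R) : set (n.-tuple R) :=
  [set s | forall i, 0 <= tnth s i <= tnth x i].

(* The point (x, y) of R^d, for l <= d; indexing the concatenation by i < d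
   avoids a cast along l + (d - l) = d. *)
Definition join (R : realType) (d l : nat)
    (x : l.-tuple R) (y : (d - l).-tuple R) : d.-tuple R :=
  [tuple nth 0 (x ++ y) i | i < d].

(* The minimum of the coordinates, for x in the unit cube and n > 0. *)
Definition min_coord (R : realType) (n : nat) (x : n.-tuple R) : R :=
  \big[Num.min/1]_(i < n) tnth x i.

Definition tuple_of_row (R : realType) (n : nat) (w : 'rV[R]_n) : n.-tuple R :=
  [tuple w ord0 i | i < n].

(* The interior relative to the unit cube; the topology is that of row
   vectors, since tuples carry none. *)
Definition cube_interior (R : realType) (n : nat) (A : set (n.-tuple R)) :
    set (n.-tuple R) :=
  [set z | unit_cube n z /\
    \forall w \near (\row_(i < n) tnth z i : 'rV[R]_n),
      unit_cube n (tuple_of_row w) -> A (tuple_of_row w)].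

Definition induced_by (R : realType) (n : nat)
    (mu : probability (n.-tuple R) R) (C : n.-tuple R -> R) : Prop :=
  forall x, unit_cube n x -> mu (box0 x) = (C x)%:E.

(* A copula is (the restriction to the unit cube of) the distribution function
   of a random vector with uniform marginals on [0, 1]. *)
Definition is_copula (R : realType) (n : nat) (C : n.-tuple R -> R) : Prop :=
  exists2 mu : probability (n.-tuple R) R, induced_by mu C &
    forall (i : 'I_n) (u : R), 0 <= u <= 1 ->
      mu [set s | tnth s i <= u] = u%:E.

Definition margin (R : realType) (d l : nat) (C : d.-tuple R -> R)
    (x : l.-tuple R) : R :=
  C (join x (nseq_tuple (d - l) 1)).

Definition zero_set (R : realType) (n : nat) (C : n.-tuple R -> R) :
    set (n.-tuple R) :=
  [set x | unit_cube n x /\ C x = 0].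

(* psi : [0, oo) -> [0, 1] extended by psi(oo) = 0; the value at -oo is junk. *)
Definition ext (R : realType) (psi : R -> R) (z : \bar R) : R :=
  if z is t%:E then psi t else 0.

(* For 0 < u <= 1 and a generator psi, the set is a singleton; for u = 0 this
   is the infimum of the zeros of psi in [0, oo]. *)
Definition pseudoinverse (R : realType) (psi : R -> R) (u : R) : \bar R :=
  ereal_inf [set z | (0 <= z)%E /\ ext psi z = u].

Definition is_generator (R : realType) (psi : R -> R) : Prop :=
  [/\ {within `[0, +oo[, continuous psi},
      forall t, 0 <= t -> 0 <= psi t <= 1,
      forall s t, 0 <= s -> s <= t -> psi t <= psi s,
      psi 0 = 1 /\ psi z @[z --> +oo] --> (0 : R) &
      forall s t : \bar R, (0 <= s)%E -> (s < t)%E ->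
        (t <= pseudoinverse psi 0)%E -> ext psi t < ext psi s].

Definition is_normalized (R : realType) (psi : R -> R) : Prop :=
  psi 1 = 2^-1.

Definition sum_pseudoinverse (R : realType) (psi : R -> R) (n : nat)
    (x : n.-tuple R) : \bar R :=
  (\sum_(i < n) pseudoinverse psi (tnth x i))%E.

Definition is_archimedean (R : realType) (d : nat) (psi : R -> R)
    (C : d.-tuple R -> R) : Prop :=
  [/\ is_generator psi, is_normalized psi, is_copula C &
      forall x, unit_cube d x -> C x = ext psi (sum_pseudoinverse psi x)].

Definition left_derivative (R : realType) (f : R -> R) (t : R) : R :=
  lim (h^-1 * (f (t + h) - f t) @[h --> 0^'-]).

(* psi^(l) for l <= d - 1, with the left-hand derivative at l = d - 1 and
   value 0 at oo. *)
Definition generator_derivative (R : realType) (d l : nat) (psi : R -> R)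
    (z : \bar R) : R :=
  if z is t%:E then
    if l == d.-1 then left_derivative (derive1n d.-2 psi) t else derive1n l psi t
  else 0.

(* K is a kernel on all of R^l; only its values on the unit cube matter, and
   any kernel on the cube extends by a constant probability. The measure mu
   is unique on Borel subsets of the cube. *)
Definition is_markov_kernel (R : realType) (d l : nat) (C : d.-tuple R -> R)
    (K : R.-pker (l.-tuple R) ~> ((d - l).-tuple R)) : Prop :=
  (forall x, unit_cube l x -> K x (unit_cube (d - l)) = 1%E) /\
  exists2 mu : probability (l.-tuple R) R, induced_by mu (margin C) &
    forall (x : l.-tuple R) (y : (d - l).-tuple R),
      unit_cube l x -> unit_cube (d - l) y ->
      (\int[mu]_(s in box0 x) K s (box0 y) = (C (join x y))%:E)%E.

(* Main.v *)
Require Import Defs.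
From HB Require Import structures.
From mathcomp Require Import all_boot all_order all_algebra.
From mathcomp Require Import all_classical all_reals all_analysis.
From mathcomp Require Import measurable_realfun ring lra.
Set Implicit Arguments.
Unset Strict Implicit.
Unset Printing Implicit Defensive.
Import Order.TTheory GRing.Theory Num.Theory.
Import numFieldNormedType.Exports.
Local Open Scope classical_set_scope.
Local Open Scope ring_scope.

(* Rectangles of the copula have nonnegative measure, so psi has alternating
   finite differences up to order d; hence the functions G_k = (-1)^k psi^(k)
   (one-sided for k = d - 1) exist on ]0, +oo[, decrease to 0, and
   G_k(t) is the integral of G_{k+1} over ]t, +oo[.  In the coordinates
   z_i = phi(x_i), boxes [0, x] become upper orthants.  There the margin of the
   first l coordinates is the measure with density G_l(z_1 + ... + z_l), and the
   conditional law given the sum s of the first l coordinates gives the orthant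
   {z >= a} mass G_l(s + a_1 + ... + a_(d-l)) / G_l(s).  Both are built by adding
   one Lebesgue coordinate at a time to a base kernel: for the conditional law
   the base is the measure with tail G_{d-1}, obtained from Lebesgue measure
   through the quantile function of G_{d-1}.  Integrating the quotient against
   the density cancels the denominator and iterates the integral relation down
   to psi(a_1 + ... + a_d). *)

(** * Finite differences and one-sided derivatives *)

(** The measure that comes with the copula is used only for the signs of differences. Kernel and
    marginal measure are not obtained by abstract disintegration: both are constructed and
    recognised by their values on boxes, which is all that [is_markov_kernel] asks for. Four
    obstacles shape the construction. (a) [G_(d-1)] is monotone and left-continuous but may jump, so
    the measure with this tail need not have a density; hence the quantile function for one
    coordinate. (b) For k >= 1, [G_k] may be unbounded near 0, so the identities live on []0, +oo[];
    the point 0 is reached only in the outermost integration, where psi itself appears and is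
    right-continuous. (c) If psi vanishes from phi(0) on, the left derivative at phi(0) may still be
    nonzero, as for a truncated power. The density is cut off at phi(0), which alters each integral
    at a single point only. (d) The denominator must be positive: a function that decreases to 0
    from a positive value has a positive slope, so [G_l] is positive wherever psi is. *)

Section finite_differences.
Variable R : realType.
Implicit Types (f : R -> R) (hs : seq R) (t : R).

Fixpoint fdiff hs f t : R :=
  if hs is h :: hs' then fdiff hs' f t - fdiff hs' f (t + h) else f t.

(** The increments may differ from one another, because they come from different coordinates of a
    rectangle. Only order exactly [n] is asked for; lower orders follow for functions vanishing at
    infinity. *)
Definition mono n f := forall hs t, size hs = n ->
  {in hs, forall h, 0 < h} -> 0 < t -> 0 <= fdiff hs f t.

Lemma fdiff_ge_cvg hs (F : nat -> R -> R) f t :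
  {in hs, forall h, 0 < h} ->
  (forall u, t <= u -> F n u @[n --> \oo] --> f u) ->
  fdiff hs (F n) t @[n --> \oo] --> fdiff hs f t.
Proof.
elim: hs t => [|h hs IH] t hs0 Ff /=; first exact: Ff.
have hs0' : {in hs, forall h, 0 < h} by move=> x xs; apply: hs0; rewrite inE xs orbT.
have h0 : 0 < h by apply: hs0; rewrite inE eqxx.
apply: cvgB; first exact: IH.
apply: IH => // u tu; apply: Ff; lra.
Qed.

Lemma fdiff_cvg0 hs f t : f x @[x --> +oo] --> 0 ->
  fdiff hs f (t + x) @[x --> +oo] --> 0.
Proof.
move=> f0; elim: hs t => [|h hs IH] t /=.
  have := @cvg_comp _ _ _ (fun x => t + x) f _ _ _ _ f0; apply.
  under eq_fun do rewrite addrC.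
  exact: cvg_addrr.
rewrite -(subr0 0); apply: cvgB; first exact: IH.
under eq_fun do rewrite addrAC; exact: IH.
Qed.

(** Let one additional increment [x] tend to infinity: the shifted difference disappears, and the
    difference of order [n] is a limit of nonnegative numbers. *)
Lemma mono_pred n f : f x @[x --> +oo] --> 0 -> mono n.+1 f -> mono n f.
Proof.
move=> f0 fn hs t hsn hs0 t0.
have H : fdiff hs f t - fdiff hs f (t + x) @[x --> +oo] --> fdiff hs f t - 0.
  by apply: cvgB; [exact: cvg_cst|exact: fdiff_cvg0].
rewrite -[X in _ <= X]subr0 -(cvg_lim (@Rhausdorff R) H).
apply: limr_ge; first by apply/cvg_ex; eexists; exact: H.
near=> x.
apply: (fn (x :: hs) t) => //; first by rewrite /= hsn.
move=> y; rewrite inE => /predU1P[->|/hs0//].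
near: x; apply: nbhs_pinfty_gt; exact: num_real.
Unshelve. all: by end_near. Qed.

Lemma mono_le n m f : (m <= n)%N -> f x @[x --> +oo] --> 0 ->
  mono n f -> mono m f.
Proof.
move=> mn f0; rewrite -(subnK mn); elim: (n - m)%N => [//|k IH].
by rewrite addSn => /(mono_pred f0); exact: IH.
Qed.

Lemma fdiff_sub hs f g t :
  fdiff hs (fun u => f u - g u) t = fdiff hs f t - fdiff hs g t.
Proof. by elim: hs t => [//|h hs IH] t /=; rewrite !IH; ring. Qed.

Lemma fdiff_mul hs f c t :
  fdiff hs (fun u => c * f u) t = c * fdiff hs f t.
Proof. by elim: hs t => [//|h hs IH] t /=; rewrite !IH; ring. Qed.

Lemma fdiff_shift hs f c t :
  fdiff hs (fun u => f (u + c)) t = fdiff hs f (t + c).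
Proof. by elim: hs t => [//|h hs IH] t /=; rewrite !IH addrAC. Qed.

End finite_differences.

Section slopes.
Variable R : realType.
Implicit Types (f g : R -> R) (t : R).

(* f is convex with f' = - g, in a form that yields one-sided derivatives and
   integrals alike. *)
Definition sandwich f g := forall a b, 0 < a -> a < b ->
  g b * (b - a) <= f a - f b <= g a * (b - a).

(* For dyadic increments, nonnegative second differences make the slopes
   monotone in n; convexity of f is not yet available at this point. *)
Definition left_slope f n t : R :=
  2 ^+ n * (f (t - 2 ^- n) - f t).

Definition neg_left_derivative f t : R := lim (left_slope f n t @[n --> \oo]).

(** A left slope is itself a scaled difference, based at the shifted point [t - 2 ^- n]. Thus one
    order of [mono] is traded for one derivative. *)
Lemma fdiff_left_slope hs f n t :
  fdiff hs (left_slope f n) t = 2 ^+ n * fdiff (2 ^- n :: hs) f (t - 2 ^- n).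
Proof.
by rewrite /left_slope fdiff_mul fdiff_sub fdiff_shift /= subrK.
Qed.

Lemma exp2V_gt0 n : 0 < 2 ^- n :> R.
Proof. by rewrite invr_gt0 exprn_gt0. Qed.

Lemma near_exp2V t : 0 < t -> \forall n \near \oo, 2 ^- n < t.
Proof.
move=> t0.
have : (2^-1 : R) ^+ n @[n --> \oo] --> 0.
  by apply: cvg_expr; rewrite gtr0_norm ?invr_gt0// invf_lt1// ltr1n.
move=> /cvgrPdist_lt /(_ _ t0); apply: filterS => n.
by rewrite sub0r normrN gtr0_norm ?exprn_gt0 ?invr_gt0// exprVn.
Qed.

Variable f : R -> R.
Hypotheses (f1 : mono 1 f) (f2 : mono 2 f).

Lemma mono1_le a b : 0 < a -> a <= b -> f b <= f a.
Proof.
move=> a0; rewrite le_eqVlt => /predU1P[->//|ab].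
have : 0 <= fdiff [:: b - a] f a.
  by apply: f1 => // x; rewrite inE => /eqP ->; lra.
by rewrite /= subrKC subr_ge0.
Qed.

Lemma mono2_le a b h : 0 < a -> a <= b -> 0 < h ->
  f b - f (b + h) <= f a - f (a + h).
Proof.
move=> a0; rewrite le_eqVlt => /predU1P[->//|ab] h0.
have : 0 <= fdiff [:: h; b - a] f a.
  by apply: f2 => // x; rewrite !inE => /orP[/eqP ->|/eqP ->]; lra.
rewrite /= subrKC; have -> : a + h + (b - a) = b + h by ring.
lra.
Qed.

Lemma left_slope_ge0 n t : 2 ^- n < t -> 0 <= left_slope f n t.
Proof.
move=> nt; rewrite mulr_ge0 ?exprn_ge0// subr_ge0.
have := exp2V_gt0 n => n0.
by apply: mono1_le; lra.
Qed.

(** Halving the step keeps the right half of the interval, where [f] drops no more than on the left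
    half by the nonnegative second difference. *)
Lemma left_slope_nincr n t : 2 ^- n < t -> left_slope f n.+1 t <= left_slope f n t.
Proof.
move=> nt; rewrite /left_slope exprSr -mulrA ler_pM2l ?exprn_gt0//.
have n0 := exp2V_gt0 n.
have e : 2 ^- n = 2 ^- n.+1 + 2 ^- n.+1 :> R.
  by rewrite exprS invfM -mulrDl; lra.
have n1 := exp2V_gt0 n.+1.
have := @mono2_le (t - 2 ^- n) (t - 2 ^- n.+1) (2 ^- n.+1).
have -> : t - 2 ^- n.+1 + 2 ^- n.+1 = t by ring.
have -> : t - 2 ^- n + 2 ^- n.+1 = t - 2 ^- n.+1 by rewrite e; ring.
rewrite -exprSr; move=> H; have := H _ _ n1.
lra.
Qed.

Lemma cvg_left_slope t : 0 < t ->
  left_slope f n t @[n --> \oo] --> neg_left_derivative f t.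
Proof.
move=> t0; have [N _ HN] := near_exp2V t0.
apply: (near_nonincreasing_is_cvgn (m := 0)); exists N => // n /= Nn.
  move=> m nm; rewrite -(subnK nm); elim: (m - n)%N => [//|k IH].
  rewrite addSn (le_trans _ IH)// left_slope_nincr//; apply: HN => /=.
  by rewrite (leq_trans Nn)// leq_addl.
by apply: left_slope_ge0; exact: HN.
Qed.

Lemma neg_left_derivative_le_slope t n : 2 ^- n < t ->
  neg_left_derivative f t <= left_slope f n t.
Proof.
move=> nt; have t0 : 0 < t by apply: lt_trans nt; exact: exp2V_gt0.
have := @cvg_left_slope _ t0 => /cvg_lim <-//.
apply: limr_le; first by apply/cvg_ex; eexists; exact: cvg_left_slope.
exists n => // m /= nm; rewrite -(subnK nm); elim: (m - n)%N => [//|k IH].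
rewrite addSn (le_trans _ IH)// left_slope_nincr//.
apply: le_lt_trans nt; rewrite lef_pV2 ?posrE ?exprn_gt0//.
by rewrite ler_eXn2l ?ltr1n// leq_addl.
Qed.

Lemma neg_left_derivative_ge0 t : 0 < t -> 0 <= neg_left_derivative f t.
Proof.
move=> t0; have /cvg_lim <-// := @cvg_left_slope _ t0.
apply: limr_ge; first by apply/cvg_ex; eexists; exact: cvg_left_slope.
by apply: filterS (near_exp2V t0) => n; exact: left_slope_ge0.
Qed.

(** Each of the [k] consecutive drops to the right of [a] is at most the drop on [[a - h, a]], and
    the drops telescope. [mono2_chain_ge] is the mirror image to the left of [b]. *)
Lemma mono2_chain_le a h k : 0 < h -> h < a ->
  f a - f (a + h *+ k) <= (f (a - h) - f a) *+ k.
Proof.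
move=> h0 ha; elim: k => [|k IH]; first by rewrite !mulr0n addr0 subrr.
rewrite [in leRHS]mulrSr.
have := @mono2_le (a - h) (a + h *+ k) h.
have hk : 0 <= h *+ k by rewrite mulrn_wge0// ltW.
rewrite subrK mulrSr addrA; move=> H; have := H _ _ h0; lra.
Qed.

Lemma mono2_chain_ge b h k : 0 < h -> 0 < b - h *+ k ->
  (f (b - h) - f b) *+ k <= f (b - h *+ k) - f b.
Proof.
move=> h0; elim: k => [|k IH]; first by rewrite !mulr0n subr0 subrr.
rewrite [in leLHS]mulrSr mulrSr => hk.
have k0 : 0 <= h *+ k by rewrite mulrn_wge0// ltW.
have := @mono2_le (b - (h *+ k + h)) (b - h) h.
have -> : b - (h *+ k + h) + h = b - h *+ k by ring.
rewrite subrK; move=> H.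
have := IH ltac:(lra); have := H hk ltac:(lra) h0; lra.
Qed.

(** Cover [[a, b]] by dyadic steps and use the chain inequalities; the covered length is off by at
    most one step, which vanishes in the limit. *)
Lemma sandwich_neg_left_derivative : sandwich f (neg_left_derivative f).
Proof.
move=> a b a0 ab; have b0 : 0 < b by lra.
have ba : 0 < b - a by lra.
apply/andP; split.
- have F : \forall n \near \oo,
     neg_left_derivative f b * (b - a - 2 ^- n) <= f a - f b.
    near=> n; have n0 := exp2V_gt0 n.
    have nb : 2 ^- n < b by near: n; exact: near_exp2V.
    have nba : 2 ^- n < b - a by near: n; exact: near_exp2V.
    (* The [k] whole steps back from [b] stay to the right of [a] and cover more than
       [b - a - 2 ^- n]. *)
    pose k := Num.truncn ((b - a) / 2 ^- n).
    have /andP[k1 k2] : k%:R <= (b - a) / 2 ^- n < k.+1%:R.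
      by apply: truncn_itv; rewrite divr_ge0 ?ltW.
    rewrite ler_pdivlMr// in k1; rewrite ltr_pdivrMr// -natr1 in k2.
    have kE : 2 ^- n *+ k = k%:R * 2 ^- n :> R by rewrite mulr_natl.
    have C1 := @mono2_chain_ge b (2 ^- n) k n0 ltac:(rewrite kE; lra).
    have C2 := @mono1_le a (b - 2 ^- n *+ k) a0 ltac:(rewrite kE; lra).
    have C3 := neg_left_derivative_le_slope nb.
    have C0 := neg_left_derivative_ge0 b0.
    apply: (@le_trans _ _ ((f (b - 2 ^- n) - f b) *+ k)); last lra.
    rewrite -[leRHS]mulr_natl.
    have -> : f (b - 2 ^- n) - f b = left_slope f n b * 2 ^- n.
      by rewrite /left_slope mulrAC mulfV ?mul1r// expf_neq0.
    apply: (@le_trans _ _ (neg_left_derivative f b * (k%:R * 2 ^- n))).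
      by rewrite ler_wpM2l//; lra.
    by rewrite [leRHS]mulrCA ler_wpM2r// mulr_ge0// ltW.
  have L : neg_left_derivative f b * (b - a - 2 ^- n) @[n --> \oo] -->
      neg_left_derivative f b * (b - a - 0).
    apply: cvgM; [exact: cvg_cst|apply: cvgB; [exact: cvg_cst|]].
    under eq_fun do rewrite -exprVn.
    by apply: cvg_expr; rewrite gtr0_norm ?invr_gt0// invf_lt1// ltr1n.
  rewrite subr0 in L; rewrite -(cvg_lim (@Rhausdorff R) L).
  by apply: limr_le => //; apply/cvg_ex; eexists; exact: L.
- have F : \forall n \near \oo,
     f a - f b <= left_slope f n a * (b - a + 2 ^- n).
    near=> n; have n0 := exp2V_gt0 n.
    have na : 2 ^- n < a by near: n; exact: near_exp2V.
    (* Here [k + 1] steps from [a] are taken, so that they pass [b]; the overshoot only lowers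
       [f]. *)
    pose k := Num.truncn ((b - a) / 2 ^- n).
    have /andP[k1 k2] : k%:R <= (b - a) / 2 ^- n < k.+1%:R.
      by apply: truncn_itv; rewrite divr_ge0 ?ltW.
    rewrite ler_pdivlMr// in k1; rewrite ltr_pdivrMr// in k2.
    have kE : 2 ^- n *+ k.+1 = k.+1%:R * 2 ^- n :> R by rewrite mulr_natl.
    have C1 := @mono2_chain_le a (2 ^- n) k.+1 n0 na.
    have C2 := @mono1_le b (a + 2 ^- n *+ k.+1) b0 ltac:(rewrite kE; lra).
    have C0 := left_slope_ge0 na.
    apply: (@le_trans _ _ ((f (a - 2 ^- n) - f a) *+ k.+1)); first lra.
    rewrite -[leLHS]mulr_natl.
    have -> : f (a - 2 ^- n) - f a = left_slope f n a * 2 ^- n.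
      by rewrite /left_slope mulrAC mulfV ?mul1r// expf_neq0.
    rewrite mulrCA ler_wpM2l//.
    by rewrite -natr1 mulrDl mul1r; lra.
  have L : left_slope f n a * (b - a + 2 ^- n) @[n --> \oo] -->
      neg_left_derivative f a * (b - a + 0).
    apply: cvgM; [exact: cvg_left_slope|apply: cvgD; [exact: cvg_cst|]].
    under eq_fun do rewrite -exprVn.
    by apply: cvg_expr; rewrite gtr0_norm ?invr_gt0// invf_lt1// ltr1n.
  rewrite addr0 in L; rewrite -(cvg_lim (@Rhausdorff R) L).
  by apply: limr_ge => //; apply/cvg_ex; eexists; exact: L.
Unshelve. all: by end_near. Qed.

Lemma mono_neg_left_derivative n : mono n.+1 f -> mono n (neg_left_derivative f).
Proof.
move=> fn hs t hsn hs0 t0.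
have L := @fdiff_ge_cvg R hs (left_slope f) (neg_left_derivative f) t hs0.
have {}L : fdiff hs (left_slope f n) t @[n --> \oo] -->
    fdiff hs (neg_left_derivative f) t.
  by apply: L => u tu; apply: cvg_left_slope; lra.
rewrite -(cvg_lim (@Rhausdorff R) L).
apply: limr_ge; first by apply/cvg_ex; eexists; exact: L.
apply: filterS (near_exp2V t0) => m mt.
rewrite fdiff_left_slope mulr_ge0 ?exprn_ge0//.
apply: fn; rewrite /= ?hsn//; last lra.
by move=> y; rewrite inE => /predU1P[->|/hs0//]; exact: exp2V_gt0.
Qed.

End slopes.

Section sandwich_theory.
Variables (R : realType) (f g : R -> R).
Hypotheses (fg : sandwich f g) (g0 : forall t : R, 0 < t -> 0 <= g t).

Lemma sandwich_nincr a b : 0 < a -> a <= b -> g b <= g a.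
Proof.
move=> a0; rewrite le_eqVlt => /predU1P[->//|ab].
have /andP[h1 h2] := fg a0 ab.
have := le_trans h1 h2; rewrite ler_pM2r//; lra.
Qed.

(** [f] is Lipschitz to the right of [t / 2] with constant [g (t / 2)]; one is added so that the
    constant may be divided by even when it is zero. *)
Lemma sandwich_continuous t : 0 < t -> {for t, continuous f}.
Proof.
move=> t0; apply/cvgrPdist_le => /= e e0.
have h0 : 0 < t / 2 by rewrite divr_gt0.
have gt0 := g0 h0.
have K0 : 0 < g (t / 2) + 1 by lra.
near=> x.
have xt : t / 2 < x.
  near: x; apply: lt_nbhsr; lra.
have xe : `|t - x| <= e / (g (t / 2) + 1).
  near: x; have := @cvg_id _ (nbhs t) => /cvgrPdist_le; apply.
  by rewrite divr_gt0.
rewrite ler_pdivlMr// in xe.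
apply: le_trans xe.
have [xt'|xt'|->] := ltgtP x t; last by rewrite !subrr normr0 mul0r.
- have /andP[h1 h2] := fg (lt_trans h0 xt) xt'.
  have Q := sandwich_nincr h0 (ltW xt).
  have Q' := g0 t0.
  have Q2 : 0 <= g t * (t - x) by rewrite mulr_ge0//; lra.
  have Q3 : g x * (t - x) <= (g (t / 2) + 1) * (t - x) by rewrite ler_wpM2r//; lra.
  rewrite ler0_norm; last lra.
  rewrite ger0_norm; lra.
- have /andP[h1 h2] := fg t0 xt'.
  have Q := @sandwich_nincr (t / 2) t h0 ltac:(lra).
  have Q' := g0 (lt_trans t0 xt').
  have Q2 : 0 <= g x * (x - t) by rewrite mulr_ge0//; lra.
  have Q3 : g t * (x - t) <= (g (t / 2) + 1) * (x - t) by rewrite ler_wpM2r//; lra.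
  rewrite ger0_norm; last lra.
  rewrite ler0_norm; lra.
Unshelve. all: by end_near. Qed.

(** Squeeze: a unit interval to the left of [x] gives [g x <= f (x - 1) - f x]. *)
Lemma sandwich_cvg0 : f x @[x --> +oo] --> 0 -> g x @[x --> +oo] --> 0.
Proof.
move=> f0.
have F : f (x - 1) @[x --> +oo] --> 0.
  have := @cvg_comp _ _ _ (fun x => x - 1) f _ _ _ _ f0; apply.
  exact: cvg_addrr.
apply: (@squeeze_cvgr _ _ _ _ (cst 0) (fun x => f (x - 1) - f x)).
- near=> x.
  have x1 : 1 < x by near: x; apply: nbhs_pinfty_gt; exact: num_real.
  have := @fg (x - 1) x ltac:(lra) ltac:(lra).
  have := g0 (lt_trans ltr01 x1); rewrite /cst.
  have -> : x - (x - 1) = 1 by ring.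
  lra.
- exact: cvg_cst.
- by rewrite -[X in _ --> X](subr0 0); exact: cvgB.
Unshelve. all: by end_near. Qed.

(** If [g t] were zero, [f] could not drop after [t], and [f t] would be at most the limit 0. *)
Lemma sandwich_gt0 t : 0 < t -> f x @[x --> +oo] --> 0 -> 0 < f t -> 0 < g t.
Proof.
move=> t0 f0 ft; rewrite lt_neqAle g0// andbT; apply/eqP => gt.
suff : f t <= 0 by lra.
rewrite -(cvg_lim (@Rhausdorff R) f0).
apply: limr_ge; first by apply/cvg_ex; eexists; exact: f0.
near=> x.
have tx : t < x by near: x; apply: nbhs_pinfty_gt; exact: num_real.
have := fg t0 tx; rewrite -gt; lra.
Unshelve. all: by end_near. Qed.

End sandwich_theory.

Lemma cvg_addl0 (R : realType) (t : R) : t + h @[h --> 0] --> t.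
Proof.
rewrite -[X in _ --> X](addr0 t).
by apply: cvgD; [exact: cvg_cst|exact: cvg_id].
Qed.

Section sandwich_derivative.
Variables (R : realType) (f g : R -> R).
Hypotheses (fg : sandwich f g).

(* Left-continuity, for a nonincreasing g. *)
Definition left_continuous_nincr := forall t u : R, 0 < t ->
  (forall s, 0 < s -> s < t -> u <= g s) -> u <= g t.

(** The difference quotient lies between [- g t] and [- g (t + h)], for either sign of [h]; its
    error is therefore at most the oscillation of [g]. *)
Lemma sandwich_slope t h : 0 < t -> 0 < t + h -> h != 0 ->
  `|h^-1 * (f (t + h) - f t) + g t| <= `|g (t + h) - g t|.
Proof.
move=> t0 th0 h0; have [hn|hp|e] := ltgtP h 0; last by rewrite e eqxx in h0.
- have /andP[h1 h2] := @fg (t + h) t th0 ltac:(lra).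
  have E : h^-1 * (f (t + h) - f t) = - ((f (t + h) - f t) / (- h)).
    by rewrite invrN mulrN opprK mulrC.
  have h1' : g t <= (f (t + h) - f t) / (- h) by rewrite ler_pdivlMr; lra.
  have h2' : (f (t + h) - f t) / (- h) <= g (t + h) by rewrite ler_pdivrMr; lra.
  rewrite E ler0_norm; last lra.
  rewrite ger0_norm; lra.
- have /andP[h1 h2] := @fg t (t + h) t0 ltac:(lra).
  have E : h^-1 * (f (t + h) - f t) = - ((f t - f (t + h)) / h).
    by rewrite mulrC -mulNr opprB.
  have h1' : g (t + h) <= (f t - f (t + h)) / h by rewrite ler_pdivlMr; lra.
  have h2' : (f t - f (t + h)) / h <= g t by rewrite ler_pdivrMr; lra.
  rewrite E ger0_norm; last lra.
  rewrite ler0_norm; lra.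
Qed.

(** The filter is left general so that one argument serves two-sided derivatives, where [g] is
    continuous, and left-hand ones, where it is only left-continuous. *)
Lemma sandwich_slope_cvg (F : set_system R) t : Filter F ->
  (\forall h \near F, `|h| < t /\ h != 0) -> 0 < t ->
  g (t + h) @[h --> F] --> g t ->
  h^-1 * (f (t + h) - f t) @[h --> F] --> - g t.
Proof.
move=> FF Fh t0 /cvgrPdist_le /= gt; apply/cvgrPdist_le => /= e e0.
near=> h.
have [h1 h2] : `|h| < t /\ h != 0 by near: h.
rewrite -opprD normrN addrC.
apply: (le_trans (sandwich_slope t0 _ h2)).
  by move: h1; rewrite ltr_norml => /andP[]; lra.
by rewrite distrC; near: h; exact: gt.
Unshelve. all: by end_near. Qed.

(** The constant [c] stands for a sign [(-1)^k]. Equality is asked only near [t], since the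
    derivatives of psi are identified on []0, +oo[] alone. *)
Lemma sandwich_derive1 (F : R -> R) (c t : R) : 0 < t ->
  (\forall u \near t, F u = c * f u) -> {for t, continuous g} ->
  derive1 F t = - c * g t.
Proof.
move=> t0 Ff gt; apply: cvg_lim => //.
have S : h^-1 * (f (t + h) - f t) @[h --> 0^'] --> - g t.
  apply: sandwich_slope_cvg => //.
    near=> h; split; near: h; [exact: dnbhs0_lt|exact: nbhs_dnbhs_neq].
  apply: (@cvg_comp _ _ _ (fun h => t + h) g) (gt).
  exact: cvg_within_filter (@cvg_addl0 R t).
have {}S : c * (h^-1 * (f (t + h) - f t)) @[h --> 0^'] --> - c * g t.
  by rewrite mulNr -mulrN; apply: cvgM => //; exact: cvg_cst.
apply: cvg_trans S; apply: near_eq_cvg.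
have Ft := nbhs_singleton Ff.
have Fh : \forall h \near 0^', F (t + h) = c * f (t + h).
  have H : t + h @[h --> 0^'] --> t by exact: cvg_within_filter (@cvg_addl0 R t).
  exact: (H _ Ff).
apply: filterS Fh => h Fh; rewrite [h + t]addrC Fh Ft.
by rewrite /GRing.scale /= mulrCA mulrBr.
Unshelve. all: by end_near. Qed.

Hypothesis g0 : forall t : R, 0 < t -> 0 <= g t.

Lemma left_continuous_nincr_cvg t : left_continuous_nincr -> 0 < t ->
  g (t + h) @[h --> 0^'-] --> g t.
Proof.
move=> gl t0; apply/cvgrPdist_le => /= e e0.
have [s [s0 st gs]] : exists s, [/\ 0 < s, s < t & g s < g t + e].
  apply: contrapT => H.
  suff : g t + e <= g t by lra.
  apply: gl => // s s0 st; rewrite leNgt; apply/negP => gs.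
  by apply: H; exists s.
near=> h.
have h0 : h < 0 by near: h; exact: nbhs_left_lt.
have hs : s - t < h by near: h; apply: nbhs_left_gt; lra.
have := sandwich_nincr fg (a := s) (b := t + h) s0 ltac:(lra).
have := sandwich_nincr fg (a := t + h) (b := t) ltac:(lra) ltac:(lra).
by move=> *; rewrite ler0_norm; lra.
Unshelve. all: by end_near. Qed.

Lemma sandwich_left_derivative (F : R -> R) (c t : R) : 0 < t ->
  (forall u, 0 < u -> F u = c * f u) -> left_continuous_nincr ->
  lim (h^-1 * (F (t + h) - F t) @[h --> 0^'-]) = - c * g t.
Proof.
move=> t0 Ff gl; apply: cvg_lim => //.
have S : h^-1 * (f (t + h) - f t) @[h --> 0^'-] --> - g t.
  apply: sandwich_slope_cvg => //; last exact: left_continuous_nincr_cvg.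
  near=> h; have h0 : h < 0 by near: h; exact: nbhs_left_lt.
  split; last by rewrite lt_eqF.
  by rewrite ltr0_norm// ltrNl; near: h; apply: nbhs_left_gt; lra.
have {}S : c * (h^-1 * (f (t + h) - f t)) @[h --> 0^'-] --> - c * g t.
  by rewrite mulNr -mulrN; apply: cvgM => //; exact: cvg_cst.
apply: cvg_trans S; apply: near_eq_cvg.
near=> h.
rewrite !Ff//; last first.
  suff : - t < h by lra.
  by near: h; apply: nbhs_left_gt; lra.
by rewrite mulrCA mulrBr.
Unshelve. all: by end_near. Qed.

End sandwich_derivative.

(** The derivative lies below each left slope, and left slopes are continuous: first let [s] tend to
    [t] in [u <= left_slope f n s], then let [n] grow. *)
Lemma left_continuous_neg_left_derivative (R : realType) (f : R -> R) :
  mono 1 f -> mono 2 f -> left_continuous_nincr (neg_left_derivative f).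
Proof.
move=> f1 f2 t u t0 gu.
have fc := sandwich_continuous (sandwich_neg_left_derivative f1 f2)
  (neg_left_derivative_ge0 f1 f2).
have H n : 2 ^- n < t -> u <= left_slope f n t.
  move=> nt; have n0 := exp2V_gt0 R n.
  have L : left_slope f n s @[s --> t^'-] --> left_slope f n t.
    apply: cvgM; first exact: cvg_cst.
    apply: cvg_within_filter; apply: cvgB; last exact: fc.
    apply: (@cvg_comp _ _ _ (fun s => s + - 2 ^- n) f).
      by apply: cvgB; [exact: cvg_id|exact: cvg_cst].
    by apply: fc; lra.
  rewrite -(cvg_lim (@Rhausdorff R) L).
  apply: limr_ge; first by apply/cvg_ex; eexists; exact: L.
  near=> s.
  have st : s < t by near: s; exact: nbhs_left_lt.
  have ns : 2 ^- n < s by near: s; exact: nbhs_left_gt.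
  by apply: (le_trans (gu _ _ st)); [lra|exact: neg_left_derivative_le_slope].
have L := @cvg_left_slope _ _ f1 f2 _ t0.
rewrite -(cvg_lim (@Rhausdorff R) L).
apply: limr_ge; first by apply/cvg_ex; eexists; exact: L.
by apply: filterS (near_exp2V t0) => n; exact: H.
Unshelve. all: by end_near. Qed.

Lemma nonincreasing_itv_measurable (R : realType) (D : set R) (g : R -> R) :
  is_interval D -> (forall s t, D s -> D t -> s <= t -> g t <= g s) ->
  measurable_fun D g.
Proof.
move=> iD gD; have mD := is_interval_measurable iD.
apply: (measurability (@RGenCInfty.G R)) => [|/= _ [_] [r] -> <-].
  exact: RGenCInfty.measurableE.
apply: is_interval_measurable => s t/= [Ds gs] [Dt gt] u /andP[su ut].
move: gs gt; rewrite !in_itv/= !andbT => gs gt.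
have Du : D u by apply: (iD s t) => //; rewrite su ut.
by split => //; rewrite (le_trans gt)// gD.
Qed.

(** * Integrals of one-sided derivatives *)

Section sandwich_integral.
Variables (R : realType) (f g : R -> R).
Hypotheses (fg : sandwich f g) (g0 : forall t : R, 0 < t -> 0 <= g t).
Let mu := @lebesgue_measure R.

Lemma sandwich_measurable (i : interval R) :
  [set` i] `<=` `]0, +oo[ -> measurable_fun [set` i] g.
Proof.
move=> i0; apply: nonincreasing_itv_measurable; first exact: interval_is_interval.
move=> s t /i0 /=; rewrite in_itv/= andbT => s0 _.
exact: (sandwich_nincr fg).
Qed.

Let sub0 (a : R) (i2 : itv_bound R) :
  0 <= a -> [set` Interval (BRight a) i2] `<=` `]0, +oo[%classic.
Proof.
move=> a0 x /=; rewrite !in_itv/= andbT => /andP[ax _]; exact: le_lt_trans ax.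
Qed.

(** The integral and the drop of [f] lie between the same two rectangle areas, [g (a + d) * d] and
    [g a * d]. *)
Lemma sandwich_integral_step (a d : R) : 0 < a -> 0 < d ->
  exists2 r, (\int[mu]_(x in `]a, (a + d)%R]) (g x)%:E = r%:E)%E &
    `|r - (f a - f (a + d))| <= (g a - g (a + d)) * d.
Proof.
move=> a0 d0; have ad : a < a + d by lra.
have /andP[h1 h2] := fg a0 ad.
have mg : measurable_fun `]a, (a + d)] (EFin \o g).
  by apply/measurable_EFinP; apply: sandwich_measurable; apply: sub0; exact: ltW.
have mad : mu `]a, (a + d)] = d%:E.
  rewrite /mu lebesgue_measure_itv/= lte_fin ad -EFinD; congr (_%:E); ring.
have I1 : ((g (a + d) * d)%:E <= \int[mu]_(x in `]a, (a + d)%R]) (g x)%:E)%E.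
  rewrite EFinM -mad -integral_cst//; apply: ge0_le_integral => //.
  - by move=> x _ /=; rewrite lee_fin g0//; lra.
  - move=> x /=; rewrite in_itv/= => /andP[ax xd]; rewrite lee_fin.
    by apply: (sandwich_nincr fg) => //; lra.
have I2 : (\int[mu]_(x in `]a, (a + d)%R]) (g x)%:E <= (g a * d)%:E)%E.
  rewrite EFinM -mad -integral_cst//; apply: ge0_le_integral => //.
  - by move=> x /=; rewrite in_itv/= => /andP[ax _]; rewrite lee_fin g0//; lra.
  - move=> x /=; rewrite in_itv/= => /andP[ax xd]; rewrite lee_fin.
    by apply: (sandwich_nincr fg) => //; lra.
move: I1 I2; case: (\int[mu]_(x in _) _)%E => [r| |]//=.
rewrite !lee_fin => r1 r2; exists r => //.
have e : a + d - a = d by ring.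
rewrite e in h1 h2.
by rewrite ler_norml; apply/andP; split; lra.
Qed.

(** The errors of the single steps telescope, so the total error is one mesh width times the total
    drop of [g]; refining the mesh then yields the exact integral. *)
Lemma sandwich_integral_steps (a d : R) n : 0 < a -> 0 < d ->
  exists2 r, (\int[mu]_(x in `]a, (a + d *+ n)%R]) (g x)%:E = r%:E)%E &
    `|r - (f a - f (a + d *+ n))| <= (g a - g (a + d *+ n)) * d.
Proof.
move=> a0 d0; elim: n => [|n [r rE rb]].
  exists 0; rewrite mulr0n addr0 ?subrr ?mul0r ?normr0//.
  by rewrite set_itvoc0 integral_set0.
have dn : 0 <= d *+ n by rewrite mulrn_wge0// ltW.
have [r' rE' rb'] := @sandwich_integral_step (a + d *+ n) d ltac:(lra) d0.
have e : a + d *+ n.+1 = a + d *+ n + d by rewrite mulrSr addrA.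
exists (r + r'); last first.
  rewrite e; set b := a + d *+ n in rb rb' *.
  have -> : r + r' - (f a - f (b + d)) =
    (r - (f a - f b)) + (r' - (f b - f (b + d))) by ring.
  apply: (le_trans (ler_normD _ _)); lra.
have mg : measurable_fun `]a, (a + d *+ n + d)] (EFin \o g).
  by apply/measurable_EFinP; apply: sandwich_measurable; apply: sub0; exact: ltW.
rewrite e (@itv_bndbnd_setU _ _ _ (BRight (a + d *+ n))) ?bnd_simp; [|lra|lra].
rewrite ge0_integral_setU//=.
- by rewrite rE rE' -EFinD.
- by rewrite -itv_bndbnd_setU ?bnd_simp//; lra.
- by move=> x; rewrite !in_itv/= => -[|] /andP[ax _]; rewrite lee_fin g0//; lra.
- apply: lt_disjoint => x y; rewrite !in_itv/= => /andP[_ xn] /andP[ny _]; lra.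
Qed.

Lemma sandwich_integral (a b : R) : 0 < a -> a < b ->
  (\int[mu]_(x in `]a, b]) (g x)%:E = (f a - f b)%:E)%E.
Proof.
move=> a0 ab.
have H n : exists2 r, (\int[mu]_(x in `]a, b]) (g x)%:E = r%:E)%E &
    `|r - (f a - f b)| <= (g a - g b) * (b - a) * n.+1%:R^-1.
  have := @sandwich_integral_steps a ((b - a) / n.+1%:R) n.+1 a0.
  have -> : (b - a) / n.+1%:R *+ n.+1 = b - a by rewrite -mulr_natr divfK.
  rewrite subrKC mulrA; apply; rewrite divr_gt0//; lra.
have [r rE _] := H 0%N.
rewrite rE; congr (_%:E); apply/eqP; rewrite -subr_eq0 -normr_le0.
have L : (g a - g b) * (b - a) * n.+1%:R^-1 @[n --> \oo] -->
    (g a - g b) * (b - a) * 0.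
  by apply: cvgM; [exact: cvg_cst|exact: cvg_harmonic].
rewrite mulr0 in L; rewrite -(cvg_lim (@Rhausdorff R) L).
apply: limr_ge; first by apply/cvg_ex; eexists; exact: L.
by apply: nearW => n; have [r'] := H n; rewrite rE => -[<-].
Qed.

(** Exhaust the half-line by bounded intervals that start strictly beyond [a]: [sandwich] says
    nothing at 0, so the left end is recovered from right-continuity of [f]. *)
Lemma sandwich_integral_pinfty (a : R) : 0 <= a -> f x @[x --> +oo] --> 0 ->
  f x @[x --> a^'+] --> f a ->
  (\int[mu]_(x in `]a, +oo[) (g x)%:E = (f a)%:E)%E.
Proof.
move=> a0 foo fa.
pose e (n : nat) : R := n.+1%:R^-1.
pose F (n : nat) : set R := `]a + e n, a + 1 + n%:R]%classic.
have n0 n : 0 < e n by rewrite invr_gt0.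
have FE : \bigcup_n F n = `]a, +oo[%classic.
  apply/seteqP; split => x /=.
    move=> [n _]; rewrite /F/= !in_itv/= andbT => /andP[h _].
    by apply: lt_trans h; rewrite ltrDl.
  rewrite in_itv/= andbT => ax.
  have X0 : 0 < x - a by lra.
  pose n := (Num.truncn (x - a)^-1 + Num.truncn (x - a))%N.
  exists n => //; rewrite /F/= in_itv/=; apply/andP; split.
    suff : e n < x - a by lra.
    rewrite /e invf_plt ?posrE//.
    apply: (lt_le_trans (truncnS_gt _)).
    by rewrite ler_nat ltnS leq_addr.
  suff : x - a <= n.+1%:R by rewrite -natr1; lra.
  apply: ltW; apply: (lt_le_trans (truncnS_gt _)).
  by rewrite ler_nat ltnS leq_addl.
have mF n : measurable_fun (F n) (EFin \o g).
  apply/measurable_EFinP; apply: sandwich_measurable.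
  by apply: sub0; have := n0 n; lra.
have nF : nondecreasing_seq F.
  apply/nondecreasing_seqP => n; rewrite subsetEset => x; rewrite /F/= !in_itv/=.
  move=> /andP[h1 h2]; apply/andP; split.
    apply: le_lt_trans h1; rewrite lerD2l lef_pV2 ?posrE//.
    by rewrite ler_nat.
  by rewrite (le_trans h2)// -natr1; lra.
have gF n x : F n x -> (0 <= (g x)%:E)%E.
  rewrite /F/= in_itv/= => /andP[h _]; rewrite lee_fin g0//.
  by have := n0 n; lra.
have L : (\int[mu]_(x in F n) (EFin \o g) x @[n --> \oo] -->
    \int[mu]_(x in \bigcup_n F n) (EFin \o g) x)%E.
  by apply: ge0_nondecreasing_set_cvg_integral => // n; exact: measurable_itv.
rewrite FE in L; apply: (cvg_unique _ L) => //.
have -> : (fun i => \int[mu]_(x in F i) (EFin \o g) x)%E =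
    (EFin \o (fun i => f (a + e i) - f (a + 1 + i%:R))).
  apply/funext => n /=; rewrite /F; have [n1|n1] := leP 1%N n.
    apply: sandwich_integral; first by have := n0 n; lra.
    have : e n <= 1 by rewrite /e invf_le1// ler1n.
    have : 1 <= n%:R :> R by rewrite ler1n.
    lra.
  (* For [n = 0] the interval is []a + 1, a + 1]], and both sides are zero. *)
  have -> : n = 0%N by case: (n) n1.
  by rewrite /e invr1 addr0 subrr set_itvoc0 integral_set0.
apply: cvg_EFin; first by apply: nearW.
rewrite -[X in _ --> X](subr0 (f a)); apply: cvgB.
- move/cvg_at_rightP : fa; apply; split; first by move=> n; have := n0 n; lra.
  rewrite -[X in _ --> X](addr0 a); apply: cvgD; first exact: cvg_cst.
  exact: cvg_harmonic.
- have := @cvg_comp _ _ _ (fun n : nat => a + 1 + n%:R) f _ _ _ _ foo; apply.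
  apply/cvgryPge => A; near=> n.
  have : A - a - 1 <= n%:R by near: n; exact: nbhs_infty_ger.
  lra.
Unshelve. all: by end_near. Qed.

End sandwich_integral.

Section monotone_chain.
Variables (R : realType) (d : nat) (psi : R -> R).
Hypotheses (psi_mono : mono d psi) (psi0 : psi x @[x --> +oo] --> 0).

(* [iterated_slope k] is (-1)^k psi^(k), with a left-hand derivative for
   k = d - 1. *)
Definition iterated_slope k : R -> R := iter k (@neg_left_derivative R) psi.
Local Notation G := iterated_slope.

Lemma iterated_slope_mono k : (k < d)%N ->
  mono (d - k) (G k) /\ G k x @[x --> +oo] --> 0.
Proof.
elim: k => [|k IH] kd; first by rewrite subn0.
have [Gk Gk0] := IH (ltnW kd).
have G1 : mono 1 (G k) by apply: (mono_le _ Gk0 Gk); rewrite subn_gt0 ltnW.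
have G2 : mono 2 (G k) by apply: (mono_le _ Gk0 Gk); rewrite ltn_subRL addn1.
split; first by apply: (mono_neg_left_derivative G1 G2); rewrite subnSK// ltnW.
apply: (sandwich_cvg0 (sandwich_neg_left_derivative G1 G2)) => // t.
exact: neg_left_derivative_ge0.
Qed.

Let mono12 k : (k.+1 < d)%N -> mono 1 (G k) /\ mono 2 (G k).
Proof.
move=> kd; have [Gk Gk0] := iterated_slope_mono (ltnW kd).
split; apply: (mono_le _ Gk0 Gk); first by rewrite subn_gt0 ltnW.
by rewrite ltn_subRL addn1.
Qed.

Lemma iterated_slope_cvg0 k : (k < d)%N -> G k x @[x --> +oo] --> 0.
Proof. by move=> /iterated_slope_mono[]. Qed.

Lemma iterated_slope_ge0 k t : (k < d)%N -> 0 < t -> 0 <= G k t.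
Proof.
move=> kd t0; have [Gk Gk0] := iterated_slope_mono kd.
by have := @mono_le _ _ 0 _ (leq0n _) Gk0 Gk [::] t erefl; apply.
Qed.

Lemma iterated_slope_nincr k s t : (k < d)%N -> 0 < s -> s <= t -> G k t <= G k s.
Proof.
move=> kd; have [Gk Gk0] := iterated_slope_mono kd.
by apply: mono1_le; apply: (mono_le _ Gk0 Gk); rewrite subn_gt0.
Qed.

Lemma iterated_slope_sandwich k : (k.+1 < d)%N -> sandwich (G k) (G k.+1).
Proof. by move=> /mono12[G1 G2]; exact: sandwich_neg_left_derivative. Qed.

Lemma iterated_slope_left_continuous k : (k.+1 < d)%N ->
  left_continuous_nincr (G k.+1).
Proof. by move=> /mono12[G1 G2]; exact: left_continuous_neg_left_derivative. Qed.

Lemma iterated_slope_continuous k t : (k.+1 < d)%N -> 0 < t ->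
  {for t, continuous (G k)}.
Proof.
move=> kd t0; apply: (sandwich_continuous (iterated_slope_sandwich kd)) => // u u0.
exact: iterated_slope_ge0.
Qed.

Lemma derive1n_iterated_slope k t : (k.+1 < d)%N -> 0 < t ->
  derive1n k psi t = (- 1) ^+ k * G k t.
Proof.
elim: k t => [|k IH] t kd t0; first by rewrite expr0 mul1r derive1n0.
rewrite derive1nS exprS mulN1r.
apply: (sandwich_derive1 (iterated_slope_sandwich (ltnW kd))) => //.
- near=> u; apply: IH; first exact: ltnW.
  by near: u; exact: lt_nbhsr.
- exact: iterated_slope_continuous.
Unshelve. all: by end_near. Qed.

(** Below the top order [G (k + 1)] is continuous and the derivatives are two-sided. At [l = d - 1]
    only left-continuity remains, which matches the left-hand derivative of the convention. *)
Lemma generator_derivative_iterated_slope l t : (1 <= l < d)%N -> 0 < t ->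
  generator_derivative d l psi t%:E = (- 1) ^+ l * G l t.
Proof.
move=> /andP[l1 ld] t0 /=; case: eqP => [lE|/eqP lE]; last first.
  apply: derive1n_iterated_slope => //.
  by rewrite ltn_neqAle ld andbT; apply: contra lE => /eqP <-.
have [k lk] : exists k, l = k.+1 by exists l.-1; rewrite prednK.
have kd : d.-2 = k by rewrite -[d.-2]/(d.-1.-1) -lE lk.
rewrite kd {}lk {lE l1} in ld *; rewrite exprS mulN1r.
apply: (sandwich_left_derivative (iterated_slope_sandwich ld)) => //.
- by move=> u u0; exact: derive1n_iterated_slope.
- exact: iterated_slope_left_continuous.
Qed.

Lemma iterated_slope_gt0 k t : (k < d)%N -> 0 < t -> 0 < psi t -> 0 < G k t.
Proof.
move=> + t0 pt; elim: k => [//|k IH] kd.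
apply: (sandwich_gt0 (iterated_slope_sandwich kd)) => //.
- by move=> u; exact: iterated_slope_ge0.
- exact/iterated_slope_cvg0/ltnW.
- exact/IH/ltnW.
Qed.

(** Beyond [s] the function [G k] vanishes both at [t] and at the midpoint of [s] and [t]; the
    sandwich between them forces [G (k + 1)] at [t] to be at most 0. *)
Lemma iterated_slope_eq0 k s t : (k < d)%N -> 0 <= s ->
  (forall u, s < u -> psi u = 0) -> s < t -> G k t = 0.
Proof.
move=> + s0 ps; elim: k t => [|k IH] t kd st; first exact: ps.
have st2 : s < (s + t) / 2 by lra.
have stt : (s + t) / 2 < t by lra.
have /andP[+ _] := iterated_slope_sandwich kd (a := (s + t) / 2) (b := t)
  ltac:(lra) stt.
rewrite !IH ?(ltnW kd)// subrr pmulr_lle0 ?subr_gt0// => Gt.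
by apply/eqP; rewrite eq_le Gt iterated_slope_ge0//; lra.
Qed.

(** The offset [c] collects the coordinates already summed. Asking only for right-continuity at
    [c + a] admits the value 0 when [k = 0]. *)
Lemma iterated_slope_integral k (a c : R) : (k.+1 < d)%N -> 0 <= a -> 0 <= c ->
  G k x @[x --> (c + a)^'+] --> G k (c + a) ->
  (\int[@lebesgue_measure R]_(z in `]a, +oo[) (G k.+1 (c + z)%R)%:E =
   (G k (c + a)%R)%:E)%E.
Proof.
move=> kd a0 c0 Gca.
have S := iterated_slope_sandwich kd.
apply: (@sandwich_integral_pinfty R (fun z => G k (c + z)) (fun z => G k.+1 (c + z))).
- move=> x y x0 xy; have := S (c + x) (c + y) ltac:(lra) ltac:(lra).
  by have -> : c + y - (c + x) = y - x by ring.
- by move=> t t0; apply: iterated_slope_ge0 => //; lra.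
- by [].
- have := @cvg_comp _ _ _ (fun x => c + x) (G k) _ _ _ _
    (iterated_slope_cvg0 (ltnW kd)); apply.
  under eq_fun do rewrite addrC.
  exact: cvg_addrr.
- apply/cvg_at_rightP => u [ua ucvg].
  move/cvg_at_rightP : Gca => /(_ (fun n => c + u n)); apply; split.
    by move=> n; rewrite ltrD2l.
  by apply: cvgD => //; exact: cvg_cst.
Qed.

End monotone_chain.

(** * Generators of Archimedean copulas *)

Section generators.
Variables (R : realType) (psi : R -> R).
Hypothesis psi_gen : is_generator psi.
Local Notation phi := (pseudoinverse psi).

Lemma generator_ge0 t : 0 <= t -> 0 <= psi t.
Proof. by case: psi_gen => _ h _ _ _ /h /andP[]. Qed.

Lemma generator_le1 t : 0 <= t -> psi t <= 1.
Proof. by case: psi_gen => _ h _ _ _ /h /andP[]. Qed.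

Lemma generator_nincr s t : 0 <= s -> s <= t -> psi t <= psi s.
Proof. by case: psi_gen => _ _ h _ _; exact: h. Qed.

Lemma generator0 : psi 0 = 1.
Proof. by case: psi_gen => _ _ _ []. Qed.

Lemma generator_cvg0 : psi x @[x --> +oo] --> 0.
Proof. by case: psi_gen => _ _ _ []. Qed.

Lemma generator_right_continuous t : 0 <= t -> psi x @[x --> t^'+] --> psi t.
Proof.
case: psi_gen => /continuous_within_itvcyP[pc p0] _ _ _ _.
rewrite le_eqVlt => /predU1P[<-//|t0].
by apply: cvg_at_right_filter; apply: pc; rewrite in_itv/= t0.
Qed.

Lemma pseudoinverse_ge0 u : (0 <= phi u)%E.
Proof. by apply: le_ereal_inf_tmp => z []. Qed.

(** The infimum of the zeros is attained: if [psi t] is positive, right-continuity keeps psi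
    positive up to some [s > t], so no zero lies below [s]. *)
Lemma generator_eq0 t : 0 <= t -> (psi t == 0) = (phi 0 <= t%:E)%E.
Proof.
move=> t0; apply/idP/idP => [/eqP pt|zt].
  by apply: ereal_inf_lbound; split; rewrite ?lee_fin.
rewrite eq_le generator_ge0// andbT leNgt; apply/negP => pt.
have /cvgrPdist_lt /(_ _ pt) := generator_right_continuous t0.
move=> H; suff : (t%:E < phi 0)%E by rewrite ltNge zt.
have [s ts ps] : exists2 s, t < s & 0 < psi s.
  near (t^'+) => s; exists s; first by near: s; exact: nbhs_right_gt.
  have : `|psi t - psi s| < psi t by near: s.
  by rewrite ltr_norml => /andP[_]; lra.
apply: (@lt_le_trans _ _ s%:E); first by rewrite lte_fin.
apply: le_ereal_inf_tmp => -[z| |]/= [z0 zE]; rewrite ?leey//.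
rewrite lee_fin leNgt; apply/negP => zs.
have := @generator_nincr z s z0 (ltW zs); lra.
Unshelve. all: by end_near. Qed.

Lemma generator_gt0 t : 0 <= t -> (0 < psi t) = (t%:E < phi 0)%E.
Proof. by move=> t0; rewrite lt0r generator_ge0// andbT generator_eq0// ltNge. Qed.

Lemma pseudoinverse0_gt0 : (0 < phi 0)%E.
Proof. by rewrite -(generator_gt0 (lexx 0)) generator0. Qed.

Lemma generator_decr s t : 0 <= s -> s < t -> 0 < psi s -> psi t < psi s.
Proof.
move=> s0 st ps; have [pt|pt] := ltP 0 (psi t); last exact: le_lt_trans ps.
case: psi_gen => _ _ _ _ /(_ s%:E t%:E); apply; rewrite ?lee_fin ?lte_fin//.
by rewrite ltW// -generator_gt0//; lra.
Qed.

Lemma generator_inj s t : 0 <= s -> 0 <= t -> 0 < psi s -> psi s = psi t -> s = t.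
Proof.
move=> s0 t0 ps st; have [ltst|ltst|//] := ltgtP s t.
- by have := generator_decr s0 ltst ps; rewrite st ltxx.
- by have := generator_decr t0 ltst; rewrite -st => /(_ ps); rewrite ltxx.
Qed.

Lemma generatorK t : 0 <= t -> 0 < psi t -> phi (psi t) = t%:E.
Proof.
move=> t0 pt; rewrite -[RHS]ereal_inf1; congr ereal_inf.
apply/seteqP; split => [[z| |]/= [z0 zE]|_ ->]//=.
- by rewrite (@generator_inj t z).
- by rewrite -zE ltxx in pt.
Qed.

Lemma pseudoinverse_exists u : 0 < u <= 1 ->
  exists t, [/\ 0 <= t, psi t = u & phi u = t%:E].
Proof.
move=> /andP[u0 u1].
have [M M0 pM] : exists2 M, 0 <= M & psi M < u.
  have /cvgrPdist_lt /(_ _ u0) H := generator_cvg0.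
  near (+oo : set_system R)%R => M; exists M; first by near: M; exact: nbhs_pinfty_ge.
  have : `|0 - psi M| < u by near: M.
  by rewrite sub0r normrN; apply: le_lt_trans; exact: ler_norm.
have [||t] := @IVT R psi 0 M u M0.
    apply: continuous_subspaceW (_ : {within `[0, +oo[, continuous psi}).
      by move=> x /=; rewrite !in_itv/= andbT => /andP[].
    by case: psi_gen.
    by rewrite generator0 ge_min le_max u1 (ltW pM) orbT.
rewrite in_itv/= => /andP[t0 _] ptu; exists t; split => //.
by rewrite -ptu generatorK// ptu.
Unshelve. all: by end_near. Qed.

(** This Galois relation turns the boxes [[0, x]] into upper orthants; it includes [u = 0]. *)
Lemma generator_le t u : 0 <= t -> 0 <= u <= 1 ->
  (psi t <= u) = (phi u <= t%:E)%E.
Proof.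
move=> t0 /andP[]; rewrite le_eqVlt => /predU1P[<- _|u0 u1].
  by rewrite -generator_eq0// eq_le generator_ge0// andbT.
have [s [s0 psu ->]] := @pseudoinverse_exists u ltac:(by rewrite u0).
rewrite lee_fin -psu; apply/idP/idP; last exact: generator_nincr.
rewrite leNgt => h; rewrite leNgt; apply: contra h => h.
apply: generator_decr => //; apply: lt_le_trans u0 _; rewrite -psu.
by apply: generator_nincr => //; exact: ltW.
Qed.

Lemma pseudoinverse1 : phi 1 = 0%E.
Proof. by rewrite -generator0 generatorK// generator0. Qed.

Lemma ext_eq0 w : (phi 0 <= w)%E -> ext psi w = 0.
Proof.
case: w => [w| |]//= zw; apply/eqP; rewrite generator_eq0//.
by rewrite -lee_fin; apply: le_trans zw; exact: pseudoinverse_ge0.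
Qed.

Lemma ext_gt0 w : (0 <= w)%E -> (w < phi 0)%E -> 0 < ext psi w.
Proof.
by case: w => [w| |]//= w0; rewrite ?generator_gt0//; case: (phi 0).
Qed.

Lemma sum_pseudoinverse_ge0 n (x : n.-tuple R) : (0 <= sum_pseudoinverse psi x)%E.
Proof. by apply: sume_ge0 => i _; exact: pseudoinverse_ge0. Qed.

(** When some [psi (t i)] is zero, the pseudoinverse returns [phi 0] instead of [t i]; both sides
    are then zero, so the formula survives. *)
Lemma archimedean_generator n (t : 'I_n -> R) : (forall i, 0 <= t i) ->
  ext psi (sum_pseudoinverse psi [tuple psi (t i) | i < n]) =
  psi (\sum_(i < n) t i).
Proof.
move=> t0; have [/existsP[i /eqP pi]|] := boolP [exists i, psi (t i) == 0].
  rewrite ext_eq0.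
    apply/esym/eqP; rewrite eq_le generator_ge0 ?sumr_ge0// andbT.
    rewrite -[leRHS]pi; apply: generator_nincr => //.
    by rewrite (bigD1 i)//= lerDl sumr_ge0.
  rewrite /sum_pseudoinverse (bigD1 i)//= tnth_mktuple pi leeDl//.
  by apply: sume_ge0 => j _; exact: pseudoinverse_ge0.
rewrite negb_exists => /forallP H.
rewrite /sum_pseudoinverse (eq_bigr (fun i => (t i)%:E)) ?sumEFin// => i _.
by rewrite tnth_mktuple generatorK// lt0r H generator_ge0.
Qed.

End generators.

(** * Rectangle volumes of an Archimedean copula as finite differences *)

Section copula_mono.
Variables (R : realType) (d : nat) (psi : R -> R) (C : d.-tuple R -> R).
Hypothesis C_arch : is_archimedean psi C.

Let psi_gen : is_generator psi. Proof. by case: C_arch. Qed.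

(** [rev] assigns the head of [hs] to coordinate [size hs - 1], so that removing the head, as
    [fdiff] does, leaves the other assignments in place. *)
Let rect (hs : seq R) (t : 'I_d -> R) : set (d.-tuple R) :=
  [set s | forall i : 'I_d,
    (if (i < size hs)%N then psi (t i + nth 0 (rev hs) i) < tnth s i
     else 0 <= tnth s i) && (tnth s i <= psi (t i))].

Let rect_measurable hs t : measurable (rect hs t).
Proof.
have -> : rect hs t = \bigcap_(i in [set: 'I_d])
    [set s | (if (i < size hs)%N then psi (t i + nth 0 (rev hs) i) < tnth s i
     else 0 <= tnth s i) && (tnth s i <= psi (t i))].
  apply/seteqP; split => [s h i _|s h i]; [exact: h|exact: (h i I)].
apply: fin_bigcap_measurable; [exact: finite_finset|move=> i _].
pose J := if (i < size hs)%N then `]psi (t i + nth 0 (rev hs) i), psi (t i)]%classic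
  else `[0, psi (t i)]%classic.
have mJ : measurable J by rewrite /J; case: ifP => _; exact: measurable_itv.
have := @measurable_tnth _ (measurableTypeR R) d i measurableT _ mJ.
rewrite setTI; congr measurable; apply/seteqP; split => s;
  by rewrite /J/=; case: ifP => _ /=; rewrite in_itv.
Qed.

(** By induction on the increments: bounding one more coordinate from below subtracts the nested
    rectangle with that coordinate shifted, which is the recursion of [fdiff]. *)
Lemma archimedean_mono : mono d psi.
Proof.
have [_ _ [P CP _] CE] := C_arch.
have H hs (t : 'I_d -> R) : (size hs <= d)%N -> {in hs, forall h, 0 < h} ->
    (forall i, 0 <= t i) -> P (rect hs t) = (fdiff hs psi (\sum_i t i))%:E.
  elim: hs t => [|h hs IH] t /= hsd hs0 t0.
    have -> : rect [::] t = box0 [tuple psi (t i) | i < d].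
      by apply/seteqP; split => s /= + i => /(_ i); rewrite tnth_mktuple.
    have U : unit_cube d [tuple psi (t i) | i < d].
      by move=> i; rewrite tnth_mktuple generator_ge0 ?generator_le1.
    by rewrite CP// CE// archimedean_generator.
  have h0 : 0 < h by apply: hs0; rewrite inE eqxx.
  have hs0' : {in hs, forall h, 0 < h}.
    by move=> x xs; apply: hs0; rewrite inE xs orbT.
  pose j := Ordinal hsd.
  pose t' i := t i + (if i == j then h else 0).
  have t'0 i : 0 <= t' i by rewrite addr_ge0//; case: ifP => // _; exact: ltW.
  have St' : \sum_i t' i = \sum_i t i + h.
    by rewrite big_split/= -big_mkcond/= big_pred1_eq.
  have sub : rect hs t' `<=` rect hs t.
    move=> s hsr i; have := hsr i; rewrite /t'.
    case: (i =P j) => [->|_]; last by rewrite addr0.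
    rewrite /= ltnn => /andP[-> h1] /=; apply: (le_trans h1).
    by apply: generator_nincr => //; lra.
  have -> : rect (h :: hs) t = rect hs t `\` rect hs t'.
    have nthE i : (i < size hs)%N -> nth 0 (rev (h :: hs)) i = nth 0 (rev hs) i.
      by move=> ih; rewrite rev_cons nth_rcons size_rev ih.
    have nthj : nth 0 (rev (h :: hs)) j = h.
      by rewrite rev_cons nth_rcons size_rev ltnn eqxx.
    apply/seteqP; split => s.
    - move=> sr; split.
        move=> i; have := sr i => /=.
        have [ih|ih] := ltnP i (size hs); first by rewrite ltnS ltnW// nthE.
        have [ih'|//] := ltnP i (size hs).+1.
        move=> /andP[h1 ->]; rewrite andbT (le_trans _ (ltW h1))//.
        apply: generator_ge0 => //; rewrite addr_ge0//.
        have -> : i = j by apply/val_inj/anti_leq; rewrite /= ih andbT -ltnS.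
        by rewrite nthj ltW.
      move=> /(_ j); have := sr j => /=; rewrite ltnn leqnn nthj /t' eqxx.
      by move=> /andP[h1 _] /andP[_]; rewrite leNgt h1.
    - move=> [sr nsr] i /=.
      have [ih|ih] := ltnP i (size hs).
        by rewrite ltnS ltnW// nthE//; have := sr i; rewrite ih.
      have [ih'|ih'] := ltnP i (size hs).+1; last first.
        by have := sr i; rewrite ltnNge ih.
      have ij : i = j by apply/val_inj/anti_leq; rewrite /= ih andbT -ltnS.
      rewrite ij nthj; have /= := sr j; rewrite ltnn => /andP[h1 ->].
      rewrite andbT ltNge; apply/negP => h2; apply: nsr => k.
      rewrite /t'; case: (k =P j) => [->|_]; last by rewrite addr0; exact: sr.
      by rewrite /= ltnn h1.
  have -> : P (rect hs t `\` rect hs t') = (P (rect hs t) - P (rect hs t'))%E.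
    rewrite -[in RHS](setIidr sub) measureD//.
    by apply: (le_lt_trans (probability_le1 P _)); rewrite ?ltry.
  by rewrite !IH ?(ltnW hsd)// -EFinD St'.
move=> hs t hsd hs0 t0.
have [d0|d0] := posnP d.
  move: hsd; rewrite d0; case: hs hs0 => //= _ _.
  by apply: generator_ge0 => //; exact: ltW.
(* Only the sum of the [t' i] enters, so all of [t] is put into one coordinate. *)
pose t' (i : 'I_d) := if i == Ordinal d0 then t else 0.
have St' : \sum_i t' i = t by rewrite -big_mkcond/= big_pred1_eq.
have := H hs t'; rewrite St' -lee_fin => <-//; first by rewrite hsd.
by move=> i; rewrite /t'; case: ifP => // _; exact: ltW.
Qed.

End copula_mono.

(** * Kernels on tuples *)

Section constant_kernel.
Context d d' (X : measurableType d) (Y : measurableType d') (R : realType).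

Definition kcst_finite (m : {finite_measure set Y -> \bar R}) (_ : X) :
  {measure set Y -> \bar R} := m.

(** Meant for Lebesgue measure, which has infinite mass; [kcst_finite] supplies the finite pieces of
    the s-finite decomposition. *)
Definition kcst (m : {sfinite_measure set Y -> \bar R}) (_ : X) :
  {measure set Y -> \bar R} := m.

Section finite.
Variable m : {finite_measure set Y -> \bar R}.

Let kcst_finite_measurable U : measurable U ->
  measurable_fun [set: X] (kcst_finite m ^~ U).
Proof. by move=> _; exact: measurable_cst. Qed.

HB.instance Definition _ :=
  isKernel.Build _ _ X Y R (kcst_finite m) kcst_finite_measurable.

Let kcst_finite_uub : measure_fam_uub (kcst_finite m).
Proof.
exists (fine (m setT) + 1)%R => x; rewrite /kcst_finite EFinD fineK ?fin_num_measure//.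
by rewrite lteDl ?fin_num_measure// lte01.
Qed.

HB.instance Definition _ :=
  Kernel_isFinite.Build _ _ X Y R (kcst_finite m) kcst_finite_uub.

End finite.

Variable m : {sfinite_measure set Y -> \bar R}.

Let kcst_measurable U : measurable U -> measurable_fun [set: X] (kcst m ^~ U).
Proof. by move=> _; exact: measurable_cst. Qed.

HB.instance Definition _ := isKernel.Build _ _ X Y R (kcst m) kcst_measurable.

Let kcst_sfinite : exists s : (R.-fker X ~> Y)^nat,
  forall x U, measurable U -> kcst m x U = kseries s x U.
Proof.
exists (fun n => kcst_finite (sfinite_measure_seq m n) : R.-fker X ~> Y).
by move=> x U mU; exact: (sfinite_measure_seqP m mU).
Qed.

HB.instance Definition _ :=
  Kernel_isSFinite.Build _ _ X Y R (kcst m) kcst_sfinite.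

End constant_kernel.

Section precomposition_kernel.
Context d0 d d' (W : measurableType d0) (X : measurableType d)
  (Y : measurableType d') (R : realType).
Variables (g : W -> X) (mg : measurable_fun [set: W] g).

Definition kpre (k : X -> {measure set Y -> \bar R}) (_ : measurable_fun [set: W] g)
  (w : W) : {measure set Y -> \bar R} := k (g w).

Section kernel.
Variable k : R.-ker X ~> Y.

Let kpre_measurable U : measurable U -> measurable_fun [set: W] (kpre k mg ^~ U).
Proof. by move=> mU; exact: measurableT_comp (measurable_kernel k _ mU) mg. Qed.

HB.instance Definition _ := isKernel.Build _ _ W Y R (kpre k mg) kpre_measurable.
End kernel.

Section finite.
Variable k : R.-fker X ~> Y.

Let kpre_uub : measure_fam_uub (kpre k mg).
Proof. by have [r kr] := measure_uub k; exists r => w; exact: kr. Qed.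

HB.instance Definition _ := Kernel_isFinite.Build _ _ W Y R (kpre k mg) kpre_uub.
End finite.
End precomposition_kernel.

Lemma kpre_sfinite d0 d d' (W : measurableType d0) (X : measurableType d)
    (Y : measurableType d') (R : realType) (g : W -> X)
    (mg : measurable_fun [set: W] g) (k : R.-sfker X ~> Y) :
  exists k' : R.-sfker W ~> Y, forall w, k' w = k (g w).
Proof.
have S : exists s : (R.-fker W ~> Y)^nat,
  forall w U, measurable U -> kpre k mg w U = kseries s w U.
  have [s sE] := sfinite_kernel k.
  exists (fun n => kpre (s n) mg : R.-fker W ~> Y) => w U mU.
  by rewrite /kpre sE.
pose k0 : R.-ker W ~> Y := kpre k mg.
pose m := Kernel_isSFinite.Build _ _ W Y R k0 S.
pose K : R.-sfker W ~> Y := HB.pack (Kernel.sort k0) m.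
by exists K.
Qed.

Section restricted_map_kernel.
Context d d' (X : measurableType d) (Y : measurableType d') (R : realType).
Variables (D : set X) (h : X -> Y).

(** Composing with this kernel restricts to [D] and pushes forward by [h] at once. The measurability
    proofs are arguments so that the kernel structure can be inferred from the term. *)
Definition kdirac_on (_ : measurable D) (_ : measurable_fun [set: X] h) (x : X) :
  {measure set Y -> \bar R} :=
  if x \in D then dirac (h x) : {measure set Y -> \bar R} else mzero.

Hypotheses (mD : measurable D) (mh : measurable_fun [set: X] h).

Let kdirac_on_measurable U : measurable U ->
  measurable_fun [set: X] (kdirac_on mD mh ^~ U).
Proof.
move=> mU.
have -> : kdirac_on mD mh ^~ U = fun x => if x \in D then (\1_U (h x))%:E else 0%E.
  by apply/funext => x; rewrite /kdirac_on; case: ifP => //; rewrite -[LHS]/(\d_(h x) U).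
apply: measurable_fun_if => //.
- by apply: (measurable_fun_bool true); rewrite setTI preimage_mem_true.
- apply: measurable_funTS; apply/measurable_EFinP.
  exact: (measurableT_comp (measurable_indic mU) mh).
Qed.

HB.instance Definition _ :=
  isKernel.Build _ _ X Y R (kdirac_on mD mh) kdirac_on_measurable.

Let kdirac_on_uub : measure_fam_uub (kdirac_on mD mh).
Proof.
exists 2 => x; rewrite /kdirac_on; case: ifP => _.
  by rewrite -[ltLHS]/(\d_(h x) setT) diracT lte_fin ltr1n.
by rewrite -[ltLHS]/(0%R%:E) lte_fin.
Qed.

HB.instance Definition _ :=
  Kernel_isFinite.Build _ _ X Y R (kdirac_on mD mh) kdirac_on_uub.

Lemma integral_kdirac_on x f : (forall y, 0 <= f y)%E -> measurable_fun [set: Y] f ->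
  (\int[kdirac_on mD mh x]_y f y = if x \in D then f (h x) else 0)%E.
Proof.
move=> f0 mf; rewrite /kdirac_on; case: ifP => _.
  rewrite integral_dirac//.
  by rewrite diracT mul1e.
exact: integral_measure_zero.
Qed.

End restricted_map_kernel.
Arguments kdirac_on {d d' X Y R D h}.

(** The composition [\;] expects its second kernel on the product [X * Y]; [k2] is pulled back along
    the second projection. *)
Lemma kernel_then d1 d2 d3 (X : measurableType d1) (Y : measurableType d2)
    (Z : measurableType d3) (R : realType) (k1 : R.-sfker X ~> Y)
    (k2 : R.-sfker Y ~> Z) :
  exists k : R.-sfker X ~> Z, forall x f, (forall z, 0 <= f z)%E ->
    measurable_fun [set: Z] f ->
    (\int[k x]_z f z = \int[k1 x]_y \int[k2 y]_z f z)%E.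
Proof.
have [k2' k2E] := kpre_sfinite (@measurable_snd _ _ X Y) k2.
exists (k1 \; k2')%E => x f f0 mf; rewrite integral_kcomp//.
by apply: eq_integral => y _; rewrite k2E.
Qed.

Lemma kernel_map_restrict d1 d2 d3 (X : measurableType d1) (Y : measurableType d2)
    (Z : measurableType d3) (R : realType) (k1 : R.-sfker X ~> Y)
    (E : set Y) (h : Y -> Z) : measurable E -> measurable_fun [set: Y] h ->
  exists k : R.-sfker X ~> Z, forall x f, (forall z, 0 <= f z)%E ->
    measurable_fun [set: Z] f ->
    (\int[k x]_z f z = \int[k1 x]_(y in E) f (h y))%E.
Proof.
move=> mE mh.
have [k kE] := kernel_then k1 (kdirac_on mE mh : R.-sfker Y ~> Z).
exists k => x f f0 mf; rewrite kE// [RHS]integral_mkcond.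
by apply: eq_integral => y _; rewrite integral_kdirac_on// patchE.
Qed.

Lemma kernel_comap_restrict d1 d2 d3 (X : measurableType d1) (Y : measurableType d2)
    (Z : measurableType d3) (R : realType) (D : set X) (g : X -> Y)
    (k2 : R.-sfker Y ~> Z) : measurable D -> measurable_fun [set: X] g ->
  exists k : R.-sfker X ~> Z, forall x f, (forall z, 0 <= f z)%E ->
    measurable_fun [set: Z] f ->
    (\int[k x]_z f z = if x \in D then \int[k2 (g x)]_z f z else 0)%E.
Proof.
move=> mD mg.
have [k kE] := kernel_then (kdirac_on mD mg : R.-sfker X ~> Y) k2.
exists k => x f f0 mf; rewrite kE// integral_kdirac_on//.
  by move=> y; exact: integral_ge0.
apply: (@measurable_fun_integral_kernel _ _ _ _ _ k2 _ f) => //.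
exact: measurable_kernel.
Qed.

Section tuple_boxes.
Variable R : realType.

Definition tsum n (z : n.-tuple R) : R := \sum_(i < n) tnth z i.

Definition upper_box n (a : n.-tuple R) : set (n.-tuple R) :=
  [set z | forall i, tnth a i <= tnth z i].

Definition tcons n (x : R) (t : n.-tuple R) : n.+1.-tuple R :=
  [the n.+1.-tuple R of x :: t].

Lemma tcons_eta n (a : n.+1.-tuple R) : a = tcons (thead a) [tuple of behead a].
Proof. by rewrite {1}(tuple_eta a); apply/val_inj. Qed.

Lemma tsum_cons n x (t : n.-tuple R) : tsum (tcons x t) = x + tsum t.
Proof.
rewrite /tsum big_ord_recl; congr +%R.
by apply: eq_bigr => i _; rewrite tnthS.
Qed.

Lemma upper_box_cons n a (b : n.-tuple R) x t :
  upper_box (tcons a b) (tcons x t) <-> a <= x /\ upper_box b t.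
Proof.
split=> [h|[ax bt] i].
  by split; [exact: (h ord0)|move=> i; have := h (lift ord0 i); rewrite !tnthS].
case: (unliftP ord0 i) => [j ->|->]; last exact: ax.
by rewrite !tnthS; exact: bt.
Qed.

Lemma measurable_tcons d (T : measurableType d) n (f : T -> R) (g : T -> n.-tuple R) :
  measurable_fun [set: T] f -> measurable_fun [set: T] g ->
  measurable_fun [set: T] (fun x => tcons (f x) (g x)).
Proof. exact: measurable_cons. Qed.

Lemma measurable_tsum n : measurable_fun [set: n.-tuple R] (@tsum n).
Proof.
by apply: measurable_sum => i; exact: measurable_tnth.
Qed.

Lemma measurable_forall_tuple n (Q : 'I_n -> set R) : (forall i, measurable (Q i)) ->
  measurable [set z : n.-tuple R | forall i, Q i (tnth z i)].
Proof.
move=> mQ.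
have -> : [set z : n.-tuple R | forall i, Q i (tnth z i)] =
    \bigcap_(i in [set: 'I_n]) ((@tnth n R ^~ i) @^-1` Q i).
  by apply/seteqP; split => [z h i _|z h i]; [exact: h|exact: (h i I)].
apply: fin_bigcap_measurable; [exact: finite_finset|move=> i _].
by rewrite -[_ @^-1` _]setTI; exact: measurable_tnth.
Qed.

Lemma measurable_upper_box n (a : n.-tuple R) : measurable (upper_box a).
Proof.
apply: (@measurable_forall_tuple n (fun i => [set x | tnth a i <= x])) => i.
have -> : [set x | tnth a i <= x] = `[tnth a i, +oo[%classic.
  by apply/seteqP; split => x /=; rewrite in_itv/= andbT.
exact: measurable_itv.
Qed.

End tuple_boxes.

Section kernels_on_tuples.
Variable R : realType.
Local Notation leb := (@lebesgue_measure R).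

Let kleb d (X : measurableType d) : R.-sfker X ~> measurableTypeR R :=
  kcst leb.

Lemma base_kernel (c : R * R -> R) : measurable_fun [set: R * R] c ->
  exists b : R.-sfker R ~> 1.-tuple R, forall s f, (forall z, 0 <= f z)%E ->
    measurable_fun [set: 1.-tuple R] f ->
    (\int[b s]_z f z = \int[leb]_u f (tcons (c (s, u)) [tuple]))%E.
Proof.
move=> mc.
have mg : measurable_fun [set: R * measurableTypeR R]
  (fun p => tcons (c p) [tuple]).
  by apply: measurable_tcons => //; exact: measurable_cst.
exists (kleb R \; (kdirac mg : R.-sfker (R * measurableTypeR R) ~> _))%E.
move=> s f f0 mf; rewrite integral_kcomp//.
by apply: eq_integral => u _; rewrite integral_dirac// diracT mul1e.
Qed.

(** The kernel argument [s] is the running sum of coordinates: a new Lebesgue coordinate [x] is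
    placed in front and [s + x] is handed on. *)
Lemma step_kernel n (k : R.-sfker R ~> n.-tuple R) :
  exists k' : R.-sfker R ~> n.+1.-tuple R, forall s f, (forall z, 0 <= f z)%E ->
    measurable_fun [set: n.+1.-tuple R] f ->
    (\int[k' s]_z f z = \int[leb]_x \int[k (s + x)%R]_t f (tcons x t))%E.
Proof.
have madd : measurable_fun [set: R * measurableTypeR R]
    (fun p : R * measurableTypeR R => p.1 + p.2).
  exact: measurable_funD.
have [k1 k1E] := kpre_sfinite madd k.
have mg : measurable_fun [set: (R * measurableTypeR R) * n.-tuple R]
    (fun p => tcons p.1.2 p.2).
  by apply: measurable_tcons => //; exact: measurableT_comp.
exists (kleb R \;
  (k1 \; (kdirac mg : R.-sfker _ ~> _)))%E.
move=> s f f0 mf; rewrite integral_kcomp//.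
apply: eq_integral => x _; rewrite integral_kcomp// k1E.
by apply: eq_integral => t _; rewrite integral_dirac// diracT mul1e.
Qed.

End kernels_on_tuples.

(** * Integrals of functions of the coordinate sum over upper orthants *)

Section box_integrals.
Variable R : realType.
Local Notation leb := (@lebesgue_measure R).
Implicit Types (F H : R -> R).

Definition nonneg_tuple n : set (n.-tuple R) := [set a | forall i, 0 <= tnth a i].

Definition radial_integral n (k : R.-sfker R ~> n.-tuple R) F s (a : n.-tuple R) :=
  (\int[k s]_(z in upper_box a) (F (s + tsum z)%R)%:E)%E.

Lemma measurable_radial n F s : measurable_fun [set: R] F ->
  measurable_fun [set: n.-tuple R] (fun z => F (s + tsum z)).
Proof.
move=> mF; apply: (measurableT_comp mF).
by apply: measurable_funD => //; exact: measurable_tsum.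
Qed.

Lemma radial_integral_step n (k : R.-sfker R ~> n.-tuple R)
    (k' : R.-sfker R ~> n.+1.-tuple R) F H s (a : R) (b : n.-tuple R) :
  (forall s f, (forall z, 0 <= f z)%E -> measurable_fun [set: n.+1.-tuple R] f ->
    \int[k' s]_z f z = \int[leb]_x \int[k (s + x)%R]_t f (tcons x t))%E ->
  measurable_fun [set: R] F -> (forall u, 0 <= F u) -> 0 <= s -> 0 <= a ->
  (forall s, 0 < s -> radial_integral k F s b = (H (s + tsum b))%:E) ->
  (radial_integral k' F s (tcons a b) =
    \int[leb]_(x in `]a, +oo[) (H (s + tsum b + x)%R)%:E)%E.
Proof.
move=> k'E mF F0 s0 a0 kH; rewrite /radial_integral integral_mkcond.
pose f := (fun z : n.+1.-tuple R => (F (s + tsum z))%:E) \_ (upper_box (tcons a b)).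
have f0 z : (0 <= f z)%E by rewrite /f patchE; case: ifP => // _; rewrite lee_fin.
have mf : measurable_fun [set: n.+1.-tuple R] f.
  apply/(measurable_restrictT _ (measurable_upper_box _)).
  by apply: measurable_funTS; apply/measurable_EFinP; exact: measurable_radial.
rewrite k'E//.
pose I x := (\int[k (s + x)%R]_t f (tcons x t))%E.
have I0 x : x < a -> I x = 0%E.
  move=> xa; rewrite /I integral0_eq// => t _; rewrite /f patchE ifF//.
  apply/negbTE/negP; rewrite inE => /upper_box_cons[ax _].
  by move: xa; rewrite ltNge ax.
have IH x : a < x -> I x = (H (s + tsum b + x))%:E.
  move=> ax; rewrite addrAC -kH; last lra.
  rewrite /radial_integral /I [RHS]integral_mkcond; apply: eq_integral => t _.
  rewrite /f !patchE; have [bt|bt] := pselect (upper_box b t).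
    rewrite !ifT ?inE//; first by rewrite tsum_cons addrA.
    by apply/upper_box_cons; split => //; exact: ltW.
  rewrite !ifF//; apply/negbTE/negP; rewrite inE//.
  by move/upper_box_cons => [].
have mI : measurable_fun [set: R] I.
  have madd : measurable_fun [set: R] (fun x : R => s + x).
    exact: measurable_funD.
  have [k1 k1E] := kpre_sfinite madd k.
  have -> : I = fun x => (\int[k1 x]_t f (tcons x t))%E.
    by apply/funext => x; rewrite /I k1E.
  apply: (@measurable_fun_integral_sfinite_kernel _ _ _ _ _
    (fun p : R * n.-tuple R => f (tcons p.1 p.2)) k1) => //.
  by apply: (measurableT_comp mf); exact: measurable_tcons.
transitivity (\int[leb]_(x in `[a, +oo[) I x)%E.
  rewrite [RHS]integral_mkcond; apply: eq_integral => x _.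
  rewrite patchE; case: ifPn => // /negP; rewrite inE/= in_itv/= andbT => /negP.
  by rewrite -ltNge => /I0.
(* The null endpoint [a] is dropped because the value of the inner integral is known only for
   [s + x > 0], which may fail at [x = a = 0]. *)
rewrite -integral_itv_obnd_cbnd; last exact: measurable_funTS.
by apply: eq_integral => x; rewrite inE/= in_itv/= andbT => /IH.
Qed.

(** [H i] is the value after [i] added coordinates. The flag [Z] allows [s = 0]: only the outermost
    integration can meet [c + a = 0], since inside it the running sum is positive, so the recursion
    calls itself with [false]. The kernel is chosen before [F] and [H]. *)
Lemma iterated_kernel m n (b : R.-sfker R ~> m.-tuple R) :
  exists k : R.-sfker R ~> (n + m).-tuple R, forall F (H : nat -> R -> R) (Z : bool),
    measurable_fun [set: R] F -> (forall u, 0 <= F u) ->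
    (forall s a, 0 < s -> nonneg_tuple a ->
      radial_integral b F s a = (H 0%N (s + tsum a))%:E) ->
    (forall i (c a : R), (i < n)%N -> 0 <= c -> 0 <= a ->
      (0 < c + a) || Z && (i.+1 == n) ->
      (\int[leb]_(x in `]a, +oo[) (H i (c + x)%R)%:E = (H i.+1 (c + a)%R)%:E)%E) ->
    forall s a, 0 <= s -> (0 < s) || Z && (0 < n)%N -> nonneg_tuple a ->
      radial_integral k F s a = (H n (s + tsum a))%:E.
Proof.
elim: n => [|n [k kP]].
  exists b => F H Z mF F0 bE _ s a s0; rewrite andbF orbF => s0'; exact: bE.
have [k' k'E] := step_kernel k.
exists k' => F H Z mF F0 bE HE s a s0 sZ a0.
rewrite (tcons_eta a).
have a0' i : 0 <= tnth [tuple of behead a] i by rewrite tnth_behead.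
have t0 : 0 <= tsum [tuple of behead a] by apply: sumr_ge0 => i _.
have ha : 0 <= thead a by exact: a0.
rewrite (radial_integral_step (H := H n) k'E)//.
  rewrite HE//; last 2 first.
  - exact: addr_ge0.
  - move: sZ; rewrite eqxx andbT => /orP[s1|->]; last by rewrite orbT.
    by rewrite ltr_wpDr// ltr_wpDr.
  by rewrite tsum_cons [thead a + _]addrC addrA.
move=> r r0; apply: (kP F H false) => //.
- move=> i c x ni c0 x0; rewrite orbF => cx; apply: HE => //.
    exact: ltn_trans (ltnSn _).
  by rewrite cx.
- exact: ltW.
- by rewrite r0.
Qed.

End box_integrals.

Section base_kernels.
Variable R : realType.
Local Notation leb := (@lebesgue_measure R).

Lemma radial_integral_base (c : R * R -> R) (b : R.-sfker R ~> 1.-tuple R)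
    (F : R -> R) (s : R)
    (a : 1.-tuple R) :
  (forall s f, (forall z, 0 <= f z)%E -> measurable_fun [set: 1.-tuple R] f ->
    \int[b s]_z f z = \int[leb]_u f (tcons (c (s, u)) [tuple]))%E ->
  measurable_fun [set: R] F -> (forall u, 0 <= F u) ->
  (radial_integral b F s a =
   \int[leb]_(u in [set u | (thead a <= c (s, u))%R]) (F (s + c (s, u))%R)%:E)%E.
Proof.
move=> bE mF F0; rewrite /radial_integral integral_mkcond [RHS]integral_mkcond bE.
- apply: eq_integral => u _; rewrite !patchE.
  have E : upper_box a (tcons (c (s, u)) [tuple]) <-> thead a <= c (s, u).
    rewrite {1}(tcons_eta a) upper_box_cons; split=> [[]//|h]; split=> // i.
    by case: i.
  rewrite tsum_cons /tsum big_ord0 addr0.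
  have [h|h] := pselect (thead a <= c (s, u)).
    by rewrite !ifT// inE//; apply/E.
  by rewrite !ifF//; apply/negbTE/negP; rewrite inE// => /E.
- by move=> z; rewrite patchE; case: ifP => // _; rewrite lee_fin.
- apply/(measurable_restrictT _ (measurable_upper_box _)).
  by apply: measurable_funTS; apply/measurable_EFinP; exact: measurable_radial.
Qed.

Lemma tsum1 (a : 1.-tuple R) : tsum a = thead a.
Proof. by rewrite (tcons_eta a) tsum_cons /tsum big_ord0 addr0. Qed.

(* Quantile transform: [tail_quantile G] pushes Lebesgue measure to the measure
   on ]0, +oo[ with tail function G. *)
Definition tail_quantile (G : R -> R) (u : R) : R :=
  if 0 < u then sup [set t | 0 < t /\ u <= G t] else 0.

Section quantile.
Variable G : R -> R.
Hypotheses (G_nincr : forall s t : R, 0 < s -> s <= t -> G t <= G s)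
  (G_left : left_continuous_nincr G) (G_cvg0 : G x @[x --> +oo] --> 0).

(** Decay of [G] bounds the set under the supremum, and left-continuity makes the supremum attained,
    so the equivalence holds with non-strict inequalities. *)
Lemma tail_quantile_ge t u : 0 < t -> (t <= tail_quantile G u) = (0 < u <= G t).
Proof.
move=> t0; rewrite /tail_quantile; case: ifPn => [u0|/negbTE u0] /=; last first.
  by rewrite leNgt t0.
set A := [set t | _].
have ubA : has_ubound A.
  have /cvgrPdist_lt /(_ _ u0) H := G_cvg0.
  near (pinfty_nbhs R) => M.
  exists M => x [x0 ux]; rewrite leNgt; apply/negP => Mx.
  have M0 : 0 < M by near: M; exact: nbhs_pinfty_gt.
  have : `|0 - G M| < u by near: M.
  rewrite sub0r normrN => /(le_lt_trans (ler_norm _)).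
  by rewrite ltNge (le_trans ux)// G_nincr// ltW.
apply/idP/idP => [tA|uG]; last by apply: ub_le_sup.
(* The set has points beyond every [s < t], which bounds [G s] from below; left-continuity carries
   the bound to [t]. *)
apply: G_left => // s s0 st.
have A0 : A !=set0.
  apply/set0P/negP => /eqP A0; move: tA; rewrite A0 sup0; lra.
have [x [x0 ux] sx] := @sup_gt _ A s A0 ltac:(lra).
by apply: (le_trans ux); apply: G_nincr => //; exact: ltW.
Unshelve. all: by end_near. Qed.

Lemma tail_quantile_ge0 u : 0 <= tail_quantile G u.
Proof.
have [[x [x0 ux]]|A0] := pselect (exists x, 0 < x /\ 0 < u <= G x).
  by apply: (le_trans (ltW x0)); rewrite tail_quantile_ge.
rewrite /tail_quantile; case: ifPn => // u0.
rewrite (_ : [set t | _] = set0) ?sup0//; apply/seteqP; split => // t [t0 ut].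
by apply: A0; exists t; rewrite u0.
Qed.

Lemma measurable_tail_quantile : measurable_fun [set: R] (tail_quantile G).
Proof.
apply: (measurability (@RGenCInfty.G R)) => [|/= _ [_] [r] -> <-].
  exact: RGenCInfty.measurableE.
rewrite setTI; have [r0|r0] := leP r 0.
  have -> : tail_quantile G @^-1` `[r, +oo[ = setT.
    apply/seteqP; split => u //= _; rewrite in_itv/= andbT.
    exact: le_trans (tail_quantile_ge0 u).
  exact: measurableT.
have -> : tail_quantile G @^-1` `[r, +oo[ = `]0, G r]%classic.
  by apply/seteqP; split => u /=; rewrite !in_itv/= andbT tail_quantile_ge.
exact: measurable_itv.
Qed.

Hypothesis G_ge0 : forall t : R, 0 < t -> 0 <= G t.

(** The coordinate is the quantile of [u] minus the running sum [s]; it is at least [a] exactly for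
    [u] in []0, G (s + a)]], whose length is the desired mass. *)
Lemma quantile_kernel : exists b : R.-sfker R ~> 1.-tuple R,
  forall (s : R) a, 0 < s -> nonneg_tuple a ->
    radial_integral b (cst 1) s a = (G (s + tsum a))%:E.
Proof.
pose c (p : R * R) := tail_quantile G p.2 - p.1.
have mc : measurable_fun [set: R * R] c.
  apply: measurable_funB => //.
  exact: (measurableT_comp measurable_tail_quantile).
have [b bE] := base_kernel mc; exists b => s a s0 a0.
have ha : 0 <= thead a by exact: a0.
rewrite (radial_integral_base (c := c) (F := cst 1) s a bE);
  [|exact: measurable_cst|by move=> u; exact: ler01].
have -> : [set u | thead a <= c (s, u)] =
    `]0, G (s + thead a)]%classic.
  apply/seteqP; split => u /=; rewrite in_itv/= /c/= -tail_quantile_ge; lra.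
rewrite (eq_integral (cst 1%E))// integral_cst//= mul1e tsum1.
rewrite lebesgue_measure_itv/= lte_fin.
have [h|h] := ltP 0 (G (s + thead a)); first by rewrite sube0.
by congr (_%:E); apply/eqP; rewrite eq_le h G_ge0//; lra.
Qed.

End quantile.

(** The mass [g s] on the empty tuple is realised as the length of []0, g s]], using the region
    under the graph. This gives an s-finite kernel even for unbounded [g]. *)
Lemma density_kernel (g : R -> R) : measurable_fun [set: R] g ->
  (forall u, 0 <= g u) -> exists b : R.-sfker R ~> 0.-tuple R,
  forall (F : R -> R) (s : R) (a : 0.-tuple R), measurable_fun [set: R] F ->
    (forall u, 0 <= F u) ->
    radial_integral b F s a = (F (s + tsum a) * g (s + tsum a))%:E.
Proof.
move=> mg g0.
pose D : set (R * measurableTypeR R) := [set p | 0 < p.2 <= g p.1].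
have mD : measurable D.
  have -> : D = (fun p => (0 < p.2) && (p.2 <= g p.1)) @^-1` [set true].
    by apply/seteqP; split.
  rewrite -[_ @^-1` _]setTI.
  have : measurable_fun [set: R * R] (fun p : R * R => (0 < p.2) && (p.2 <= g p.1)).
    apply: measurable_and.
      by apply: measurable_fun_ltr => //; exact: measurable_cst.
    by apply: measurable_fun_ler => //; exact: (measurableT_comp mg).
  exact.
have mnil : measurable_fun [set: R * measurableTypeR R]
  (fun=> [tuple] : 0.-tuple R) by exact: measurable_cst.
pose kD : R.-sfker (R * measurableTypeR R) ~> 0.-tuple R := kdirac_on mD mnil.
exists ((kcst leb : R.-sfker R ~> measurableTypeR R) \; kD)%E.
move=> F s a mF F0.
have ta (t : 0.-tuple R) : tsum t = 0 by rewrite /tsum big_ord0.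
rewrite /radial_integral.
have -> : upper_box a = setT by apply/seteqP; split => // z _ [].
rewrite integral_kcomp//; last 2 first.
- by move=> z; rewrite lee_fin.
- by apply/measurable_EFinP; exact: measurable_radial.
transitivity (\int[leb]_(u in `]0%R, g s]) (F s)%:E)%E.
  rewrite [RHS]integral_mkcond; apply: eq_integral => u _.
  rewrite integral_kdirac_on//; last 2 first.
  - by move=> z; rewrite lee_fin.
  - by apply/measurable_EFinP; exact: measurable_radial.
  have -> : ((s, u) \in D) = (u \in `]0, g s]%classic).
    by apply/idP/idP => /set_mem h; apply/mem_set; move: h; rewrite /D/= in_itv.
  by rewrite patchE ta addr0.
rewrite ta addr0 integral_cst//= lebesgue_measure_itv/= lte_fin.
have [h|h] := ltP 0 (g s); first by rewrite sube0.
have -> : g s = 0 by apply/eqP; rewrite eq_le h g0.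
by rewrite mule0 mulr0.
Qed.

End base_kernels.

(** * Kernels in the coordinates of an Archimedean copula *)

Lemma is_interval_lt_ereal (R : realType) (z : \bar R) :
  is_interval [set u : R | 0 < u /\ (u%:E < z)%E].
Proof.
move=> s t /= [s0 _] [_ tz] u /andP[su ut].
split; first exact: lt_le_trans su.
by apply: le_lt_trans tz; rewrite lee_fin.
Qed.

Lemma measurable_if_lt_ereal (R : realType) (z : \bar R) (f : R -> R) (c : R) :
  measurable_fun [set u : R | 0 < u /\ (u%:E < z)%E] f ->
  measurable_fun [set: R] (fun u => if (0 < u) && (u%:E < z)%E then f u else c).
Proof.
move=> mf.
have E : (fun u : R => (0 < u) && (u%:E < z)%E) @^-1` [set true] =
    [set u : R | 0 < u /\ (u%:E < z)%E].
  by apply/seteqP; split => u /= /andP.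
apply: measurable_fun_if => //; last by rewrite setTI E.
apply: (measurable_fun_bool true); rewrite setTI E.
exact: is_interval_measurable (@is_interval_lt_ereal R z).
Qed.

Lemma min_coord_eq1 (R : realType) n (x : n.-tuple R) : unit_cube n x ->
  min_coord x = 1 -> forall i, tnth x i = 1.
Proof.
move=> xI x1 i; have /bigmin_geP[_ /(_ i isT) h] : 1 <= min_coord x by rewrite x1.
by apply/eqP; rewrite eq_le h andbT; have /andP[] := xI i.
Qed.

Lemma min_coord_gt0 (R : realType) n (x : n.-tuple R) i :
  0 < min_coord x -> 0 < tnth x i.
Proof. by move=> /bigmin_gtP[_]; exact. Qed.

Lemma min_coord_lt1 (R : realType) n (x : n.-tuple R) :
  min_coord x < 1 -> exists i, tnth x i < 1.
Proof.
move=> x1; apply: contrapT => h; move: x1; rewrite ltNge => /negP; apply.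
apply/bigmin_geP; split=> // i _; rewrite leNgt; apply/negP => xi.
by apply: h; exists i.
Qed.

Section generator_maps.
Variables (R : realType) (psi : R -> R).
Hypothesis psi_gen : is_generator psi.
Local Notation phi := (pseudoinverse psi).

(* Truncating at 0 makes the map monotone, hence measurable: psi is arbitrary
   on negative reals. *)
Definition push_psi n (z : n.-tuple R) : n.-tuple R :=
  [tuple psi (Num.max (tnth z i) 0) | i < n].

Definition real_pseudoinverse (u : R) : R :=
  if (0 < u) && (u <= 1) then fine (phi u) else 0.

Definition sum_real_pseudoinverse n (x : n.-tuple R) : R :=
  \sum_(i < n) real_pseudoinverse (tnth x i).

(* The points x at which the conditional law is given by the quotient. *)
Definition regular_tuple n : set (n.-tuple R) :=
  [set x | (forall i, 0 < tnth x i <= 1) /\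
    (0 < sum_real_pseudoinverse x /\ ((sum_real_pseudoinverse x)%:E < phi 0)%E)].

Lemma measurable_push_psi n : measurable_fun [set: n.-tuple R] (@push_psi n).
Proof.
apply/measurable_fun_tnthP => i.
have -> : (tnth (T:=R))^~ i \o @push_psi n =
    (fun u => psi (Num.max u 0)) \o (@tnth n R ^~ i).
  by apply/funext => z /=; rewrite tnth_mktuple.
apply: measurableT_comp; last exact: measurable_tnth.
apply: nonincreasing_measurable => // u v uv.
apply: generator_nincr => //; first by rewrite le_max lexx orbT.
by rewrite ge_max !le_max uv lexx orbT.
Qed.

Lemma real_pseudoinverse_ge0 u : 0 <= real_pseudoinverse u.
Proof.
rewrite /real_pseudoinverse; case: ifP => // _.
exact/fine_ge0/pseudoinverse_ge0.
Qed.

Lemma real_pseudoinverseE u : 0 < u <= 1 -> phi u = (real_pseudoinverse u)%:E.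
Proof.
move=> u01; rewrite /real_pseudoinverse u01.
by have [t [_ _ ->]] := pseudoinverse_exists psi_gen u01.
Qed.

Lemma measurable_real_pseudoinverse : measurable_fun [set: R] real_pseudoinverse.
Proof.
apply: measurable_fun_if => //.
  apply: measurable_and.
    by apply: measurable_fun_ltr => //; exact: measurable_cst.
  by apply: measurable_fun_ler => //; exact: measurable_cst.
rewrite setTI.
have -> : (fun x : R => (0 < x) && (x <= 1)) @^-1` [set true] = `]0, 1]%classic.
  by apply/seteqP; split => u /=; rewrite in_itv.
apply: nonincreasing_itv_measurable; first exact: interval_is_interval.
move=> s t /=; rewrite !in_itv/= => s01 t01 st.
have [a [a0 pa pha]] := pseudoinverse_exists psi_gen s01.
have [b [b0 pb phb]] := pseudoinverse_exists psi_gen t01.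
rewrite pha phb/= -lee_fin -phb -generator_le// ?pa//.
by case/andP: t01 => /ltW ->.
Qed.

Lemma measurable_sum_real_pseudoinverse n :
  measurable_fun [set: n.-tuple R] (@sum_real_pseudoinverse n).
Proof.
apply: measurable_sum => i.
apply: (@measurableT_comp _ _ _ _ _ _ real_pseudoinverse).
  exact: measurable_real_pseudoinverse.
exact: measurable_tnth.
Qed.

Lemma measurable_regular_tuple n : measurable (@regular_tuple n).
Proof.
have -> : @regular_tuple n = [set x | forall i, `]0, 1]%classic (tnth x i)] `&`
    (@sum_real_pseudoinverse n @^-1` [set u | 0 < u /\ (u%:E < phi 0)%E]).
  apply/seteqP; split => [x [h ?]|x [h ?]]; split=> //= i; have := h i;
    by rewrite /= in_itv.
apply: measurableI.
  by apply: (@measurable_forall_tuple R n (fun=> `]0, 1]%classic)) => i;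
    exact: measurable_itv.
rewrite -[_ @^-1` _]setTI; apply: measurable_sum_real_pseudoinverse => //.
exact: is_interval_measurable (@is_interval_lt_ereal R (phi 0)).
Qed.

Lemma sum_pseudoinverse_fin n (x : n.-tuple R) : (forall i, 0 < tnth x i <= 1) ->
  sum_pseudoinverse psi x = (sum_real_pseudoinverse x)%:E.
Proof.
move=> x01; rewrite /sum_pseudoinverse /sum_real_pseudoinverse -sumEFin.
by apply: eq_bigr => i _; rewrite real_pseudoinverseE.
Qed.

Lemma push_psiE n (z : n.-tuple R) i : nonneg_tuple z ->
  tnth (push_psi z) i = psi (tnth z i).
Proof. by move=> z0; rewrite tnth_mktuple max_l//; exact: z0. Qed.

Lemma tsum_ge n (z : n.-tuple R) i : nonneg_tuple z -> tnth z i <= tsum z.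
Proof.
move=> z0; rewrite /tsum (bigD1 i)//= lerDl sumr_ge0// => j _; exact: z0.
Qed.

Lemma push_psi_sum n (z : n.-tuple R) : nonneg_tuple z ->
  (forall i, 0 < tnth (push_psi z) i) -> sum_real_pseudoinverse (push_psi z) = tsum z.
Proof.
move=> z0 pz; apply: eq_bigr => i _; have := pz i; rewrite push_psiE// => pzi.
have zi : 0 <= tnth z i by exact: z0.
by rewrite /real_pseudoinverse pzi (generator_le1 psi_gen)//= generatorK.
Qed.

Lemma good_push_psi n (z : n.-tuple R) : nonneg_tuple z ->
  regular_tuple (push_psi z) <-> 0 < tsum z /\ ((tsum z)%:E < phi 0)%E.
Proof.
move=> z0; split=> [[p01 ps]|[tz0 tz]].
  by rewrite push_psi_sum// in ps => i; have /andP[] := p01 i.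
have p01 i : 0 < tnth (push_psi z) i <= 1.
  have zi : 0 <= tnth z i by exact: z0.
  rewrite push_psiE// (generator_gt0 psi_gen)// (generator_le1 psi_gen)// andbT.
  by apply: le_lt_trans tz; rewrite lee_fin; exact: tsum_ge.
by split=> //; rewrite push_psi_sum// => i; have /andP[] := p01 i.
Qed.

(** The corner of the orthant is [phi (x_i)] in each coordinate. It fails to exist when some value
    is infinite, and then no real point reaches the box. *)
Lemma push_psi_box n (x : n.-tuple R) : unit_cube n x ->
  (exists b, [/\ nonneg_tuple b, sum_pseudoinverse psi x = (tsum b)%:E &
     @nonneg_tuple R n `&` (@push_psi n @^-1` box0 x) = upper_box b]) \/
  (sum_pseudoinverse psi x = +oo%E /\
     @nonneg_tuple R n `&` (@push_psi n @^-1` box0 x) = set0).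
Proof.
move=> xI.
have E z : nonneg_tuple z ->
    box0 x (push_psi z) <-> forall i, (phi (tnth x i) <= (tnth z i)%:E)%E.
  move=> z0; split=> h i; have zi : 0 <= tnth z i by exact: z0.
    by rewrite -generator_le//; have := h i; rewrite push_psiE// => /andP[].
  by rewrite push_psiE// (generator_ge0 psi_gen)//= (generator_le psi_gen)//.
have [fin|/existsNP[i infi]] := pselect (forall i, phi (tnth x i) \is a fin_num).
  left; exists [tuple fine (phi (tnth x i)) | i < n].
  have b0 : nonneg_tuple [tuple fine (phi (tnth x i)) | i < n].
    by move=> i; rewrite tnth_mktuple; apply/fine_ge0/pseudoinverse_ge0.
  split=> //.
    rewrite /tsum -sumEFin; apply: eq_bigr => i _.
    by rewrite tnth_mktuple fineK.
  apply/seteqP; split => [z [z0 /(E z z0) h] i|z h].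
    by rewrite tnth_mktuple -lee_fin fineK.
  have z0 : nonneg_tuple z by move=> i; apply: le_trans (h i); exact: b0.
  split=> //; apply/(E z z0) => i; have := h i.
  by rewrite tnth_mktuple -lee_fin fineK.
have {}infi : phi (tnth x i) = +oo%E.
  have := pseudoinverse_ge0 psi (tnth x i); move: infi.
  by case: (phi _).
right; split.
  rewrite /sum_pseudoinverse (bigD1 i)//= infi addye//.
  by rewrite gt_eqF// (lt_le_trans (ltNy0))// sume_ge0// => j _; exact: pseudoinverse_ge0.
by apply/seteqP; split => // z [z0 /(E z z0) /(_ i)]; rewrite infi.
Qed.

End generator_maps.

Section archimedean_kernels.
Variables (R : realType) (d : nat) (psi : R -> R).
Hypotheses (psi_gen : is_generator psi) (psi_mono : mono d psi).
Local Notation phi := (pseudoinverse psi).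
Local Notation G := (iterated_slope psi).
Local Notation leb := (@lebesgue_measure R).

Let psi0 : psi x @[x --> +oo] --> 0 := generator_cvg0 psi_gen.

(** Inside the half-line [G k] is continuous; at 0 only psi itself is controlled. *)
Lemma iterated_slope_right_continuous k u : (k.+1 < d)%N -> 0 <= u ->
  (0 < u) || (k == 0%N) -> G k x @[x --> u^'+] --> G k u.
Proof.
move=> kd u0 /orP[u1|/eqP ->]; last exact: generator_right_continuous.
by apply: cvg_at_right_filter; apply: (iterated_slope_continuous psi_mono).
Qed.

(** The base coordinate carries the tail [G (d - 1)]; each of the [m - 1] Lebesgue coordinates
    lowers the index by one, ending at [d - 1 - (m - 1) = k]. *)
Lemma conditional_kernel m k : (1 < d)%N -> (k + m)%N = d -> (0 < m)%N ->
  exists M : R.-sfker R ~> m.-tuple R, forall s a, 0 < s -> nonneg_tuple a ->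
    radial_integral M (cst 1) s a = (G k (s + tsum a))%:E.
Proof.
move=> d1 kmd; case: m => // n in kmd *; move=> _.
have dE : d.-2.+2 = d by case: (d) d1 => [|[]].
have d1E : d.-1 = d.-2.+1 by rewrite -{1}dE.
have dd : (d.-2.+1 < d)%N by rewrite -{2}dE.
have [b bP] : exists b : R.-sfker R ~> 1.-tuple R,
    forall (s : R) a, 0 < s -> nonneg_tuple a ->
    radial_integral b (cst 1) s a = (G d.-1 (s + tsum a))%:E.
  rewrite d1E; apply: quantile_kernel.
  - by move=> s t; exact: (iterated_slope_nincr psi_mono).
  - exact: (iterated_slope_left_continuous psi_mono).
  - exact: (iterated_slope_cvg0 psi_mono).
  - by move=> t; exact: (iterated_slope_ge0 psi_mono).
have [M MP] := iterated_kernel n b.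
suff : exists M : R.-sfker R ~> (n + 1).-tuple R,
    forall s a, 0 < s -> nonneg_tuple a ->
    radial_integral M (cst 1) s a = (G k (s + tsum a))%:E by rewrite addn1.
exists M => s a s0 a0.
have -> : k = (d.-1 - n)%N by rewrite -kmd addnS /= addnK.
apply: (MP _ (fun i => G (d.-1 - i)) false).
- exact: measurable_cst.
- by move=> u; exact: ler01.
- by move=> s' a' s'0 a'0; rewrite subn0; exact: bP.
- move=> i c x ni c0 x0; rewrite orbF => cx.
  have nd : (n <= d.-1)%N by rewrite -kmd addnS leq_addl.
  have iE : (d.-1 - i)%N = (d.-1 - i.+1).+1 by rewrite subnSK// (leq_trans ni).
  have id : ((d.-1 - i.+1).+1 < d)%N.
    by rewrite -iE (leq_ltn_trans (leq_subr _ _))// ltn_predL ltnW.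
  rewrite iE; apply: (iterated_slope_integral psi_mono) => //.
  by apply: iterated_slope_right_continuous; rewrite ?cx// ltW.
- exact: ltW.
- by rewrite s0.
- exact: a0.
Qed.

(** The weight [F] makes one statement serve twice: [F = 1], [T = 0] gives the margin, while the
    quotient with [T] the sum over [y] gives the copula. *)
Lemma marginal_kernel l : (0 < l < d)%N ->
  exists N : R.-sfker R ~> l.-tuple R, forall (F : R -> R) (T : \bar R),
    measurable_fun [set: R] F -> (forall u, 0 <= F u) -> (0 <= T)%E ->
    (forall u : R, 0 < u -> (u%:E < phi 0)%E -> F u * G l u = ext (G l) (u%:E + T)%E) ->
    forall a, nonneg_tuple a ->
      radial_integral N F 0 a = (ext psi ((tsum a)%:E + T)%E)%:E.
Proof.
move=> /andP[l0 ld].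
(* Cutting the density at [phi 0] confines it to the range where the relation between [F] and [G l]
   is assumed. *)
pose g u := if (0 < u) && (u%:E < phi 0)%E then G l u else 0.
have g0 u : 0 <= g u.
  by rewrite /g; case: ifP => // /andP[u0 _]; exact: (iterated_slope_ge0 psi_mono).
have mg : measurable_fun [set: R] g.
  apply: measurable_if_lt_ereal.
  apply: nonincreasing_itv_measurable => [|s t [s0 _] _].
    exact: is_interval_lt_ereal.
  exact: (iterated_slope_nincr psi_mono).
have [b bP] := density_kernel mg g0.
have [N NP] := iterated_kernel l b.
suff : exists N : R.-sfker R ~> (l + 0).-tuple R, forall (F : R -> R) (T : \bar R),
    measurable_fun [set: R] F -> (forall u, 0 <= F u) -> (0 <= T)%E ->
    (forall u : R, 0 < u -> (u%:E < phi 0)%E -> F u * G l u = ext (G l) (u%:E + T)%E) ->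
    forall a, nonneg_tuple a ->
      radial_integral N F 0 a = (ext psi ((tsum a)%:E + T)%E)%:E by rewrite addn0.
exists N => F T mF F0 T0 FG a a0.
case: T => [t| |] in T0 FG *; last by rewrite leNgt ltNye in T0.
(* For [T = +oo] the product [F * g] is identically zero, and so is the right-hand side. *)
2: {
  have Fg0 u : F u * g u = 0.
    rewrite /g; case: ifP => [/andP[u0 uz]|_]; last by rewrite mulr0.
    by rewrite FG// addey.
  rewrite addey//= (NP F (fun=> cst 0) true)// ?l0//.
  - by move=> s a' s0 a'0; rewrite bP// Fg0.
  - by move=> *; rewrite integral0.
  - by rewrite orbT. }
rewrite lee_fin in T0.
(* Level 0 must be the true integrand of the base kernel; it agrees with the shifted [G l] only
   almost everywhere. The later levels are exact. *)
pose H i : R -> R := if i is i.+1 then fun u => G (l - i.+1) (u + t)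
  else fun u => F u * g u.
have HlE u : H l u = psi (u + t) by rewrite /H; case: (l) l0 => // l' _; rewrite subnn.
rewrite -EFinD/= (NP F H true)// ?l0//.
- by rewrite add0r HlE.
- by move=> s a' s0 a'0; rewrite bP.
2: by rewrite orbT.
- move=> i c x il c0 x0 cx.
  have liE : (l - i)%N = (l - i.+1).+1 by rewrite subnSK.
  have lid : ((l - i.+1).+1 < d)%N by rewrite -liE (leq_ltn_trans (leq_subr _ _)).
  have ct : 0 <= c + t by rewrite addr_ge0.
  transitivity (\int[leb]_(y in `]x, +oo[)
      (G (l - i.+1).+1 (c + t + y)%R)%:E)%E; last first.
    rewrite (iterated_slope_integral psi_mono psi0 lid x0 ct) ?[H i.+1 _]/=.
      by rewrite addrAC.
    apply: iterated_slope_right_continuous => //; first by rewrite addr_ge0.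
    move: cx => /orP[cx|/=/eqP ->]; last by rewrite subnn eqxx orbT.
    by rewrite addrAC ltr_wpDr.
  case: i => [|i] in il cx liE lid *; last first.
    by apply: eq_integral => y _; rewrite /H liE addrAC.
  rewrite -liE subn0.
  apply: ae_eq_integral => //.
  - apply: measurable_funTS; apply/measurable_EFinP.
    have madd : measurable_fun [set: R] (fun y : R => c + y) by exact: measurable_funD.
    by apply: measurable_funM; exact: (measurableT_comp _ madd).
  - apply/measurable_EFinP; apply: nonincreasing_itv_measurable.
      exact: interval_is_interval.
    move=> s s' /=; rewrite !in_itv/= !andbT => xs xs' ss'.
    by apply: (iterated_slope_nincr psi_mono) => //; lra.
  (* Below [phi 0] the integrands agree by the relation on [F]; above it [G l] vanishes. They can
     differ only where [c + y] equals [phi 0], a single point. *)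
  - have sub : ~` [set y | `]x, +oo[%classic y ->
        (H 0%N (c + y))%:E = (G l (c + t + y))%:E] `<=` [set y : R | phi 0 = (c + y)%:E].
      move=> y /= /not_implyP[]; rewrite in_itv/= andbT => xy Hy.
      apply: contrapT => yz; apply: Hy; congr (_%:E).
      have cy : 0 < c + y by lra.
      rewrite addrAC /H /g cy/=; case: ifPn => [uz|uz]; first by rewrite FG.
      rewrite mulr0; apply/esym; rewrite -leNgt in uz.
      have zF : phi 0 = (fine (phi 0))%:E.
        rewrite fineK// ge0_fin_numE ?pseudoinverse_ge0//.
        by rewrite (le_lt_trans uz)// ltry.
      have zc : fine (phi 0) < c + y.
        by rewrite -lte_fin -zF lt_neqAle uz andbT; apply/eqP.
      apply: (@iterated_slope_eq0 R d psi psi_mono psi0 l (fine (phi 0))) => //.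
      + exact/fine_ge0/pseudoinverse_ge0.
      + move=> u zu; apply/eqP; rewrite generator_eq0//; last first.
          by apply: le_trans (ltW zu); exact/fine_ge0/pseudoinverse_ge0.
        by rewrite zF lee_fin ltW.
      + lra.
    have [A [mA A0 zA]] : leb.-negligible [set y : R | phi 0 = (c + y)%:E].
      case: (phi 0) => [z| |]; last 2 first.
      - by rewrite (_ : [set y | _] = set0); [exact: negligible_set0|by apply/seteqP; split].
      - by rewrite (_ : [set y | _] = set0); [exact: negligible_set0|by apply/seteqP; split].
      exists [set z - c]; split => //; first exact: lebesgue_measure_set1.
      by move=> y /= -[->]; rewrite addrAC subrr add0r.
    by exists A; split => //; exact: subset_trans zA.
Qed.

End archimedean_kernels.

Section join.
Variables (R : realType) (psi : R -> R) (d l : nat).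
Hypothesis ld : (l <= d)%N.
Implicit Types (x : l.-tuple R) (y : (d - l).-tuple R).

Lemma sum_pseudoinverse_big n (x : n.-tuple R) :
  sum_pseudoinverse psi x = (\sum_(u <- x) pseudoinverse psi u)%E.
Proof. by rewrite big_tuple. Qed.

Lemma sum_pseudoinverse_join x y :
  sum_pseudoinverse psi (join x y) =
  (sum_pseudoinverse psi x + sum_pseudoinverse psi y)%E.
Proof.
rewrite !(sum_pseudoinverse_big x) !(sum_pseudoinverse_big y) -big_cat/=.
rewrite (big_nth 0) size_cat !size_tuple subnKC// big_mkord.
by apply: eq_bigr => i _; rewrite tnth_mktuple.
Qed.

Lemma unit_cube_join x y : unit_cube l x -> unit_cube (d - l) y ->
  unit_cube d (join x y).
Proof.
move=> xI yI i; rewrite tnth_mktuple.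
have : nth 0 (x ++ y) i \in x ++ y.
  by apply: mem_nth; rewrite size_cat !size_tuple subnKC.
by rewrite mem_cat => /orP[] /tnthP[j ->].
Qed.

End join.

(** On the boundary level with finite sum, raising one coordinate slightly lowers the sum below
    [phi 0] and leaves the zero set. An infinite sum is kept as a separate case; there the kernel is
    0 by the convention at infinity. *)
Lemma cube_interior_zero_set (R : realType) d (psi : R -> R) (C : d.-tuple R -> R)
    (z : d.-tuple R) : is_archimedean psi C -> cube_interior (zero_set C) z ->
  (pseudoinverse psi 0 < sum_pseudoinverse psi z)%E \/
  sum_pseudoinverse psi z = +oo%E.
Proof.
move=> [psi_gen _ _ CE] [zI near_z].
pose rz : 'rV[R]_d := \row_(i < d) tnth z i.
have zero w : unit_cube d w -> C w = 0 ->
    (pseudoinverse psi 0 <= sum_pseudoinverse psi w)%E.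
  move=> wI; rewrite CE// => w0; rewrite leNgt; apply/negP => h.
  have := ext_gt0 psi_gen (sum_pseudoinverse_ge0 psi w) h.
  by rewrite w0 ltxx.
have rzE : tuple_of_row rz = z.
  by apply: eq_from_tnth => i; rewrite tnth_mktuple mxE.
have z0 : (pseudoinverse psi 0 <= sum_pseudoinverse psi z)%E.
  have := nbhs_singleton near_z; rewrite rzE => /(_ zI) [_]; exact: zero.
move: z0; rewrite le_eqVlt => /predU1P[zE|]; last by left.
have [zfin|zinf] := ltP (sum_pseudoinverse psi z) +oo%E; last first.
  by right; apply/eqP; rewrite eq_le zinf leey.
exfalso.
have fin i : pseudoinverse psi (tnth z i) \is a fin_num.
  rewrite ge0_fin_numE ?pseudoinverse_ge0//; apply: le_lt_trans zfin.
  rewrite /sum_pseudoinverse (bigD1 i)//= leeDl//.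
  by apply: sume_ge0 => j _; exact: pseudoinverse_ge0.
(* A coordinate that can be raised inside the cube exists: if all were 1, the sum would be 0, which
   is less than [phi 0]. *)
have [i zi] : exists i, tnth z i < 1.
  apply: contrapT => h.
  have z1 i : tnth z i = 1.
    have /andP[_ zi] := zI i; apply/eqP; rewrite eq_le zi/= leNgt.
    by apply/negP => zi'; apply: h; exists i.
  have := pseudoinverse0_gt0 psi_gen; rewrite zE.
  by rewrite /sum_pseudoinverse big1 ?ltxx// => i _; rewrite z1 pseudoinverse1.
have L : rz + e *: delta_mx ord0 i @[e --> 0] --> rz.
  have : rz + e *: delta_mx ord0 i @[e --> (0 : R)] --> rz + 0 *: delta_mx ord0 i.
    by apply: cvgD; [exact: cvg_cst|apply: cvgZr_tmp; exact: cvg_id].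
  by rewrite scale0r addr0.
have L' : \forall e \near 0^'+, unit_cube d (tuple_of_row (rz + e *: delta_mx ord0 i)) ->
    zero_set C (tuple_of_row (rz + e *: delta_mx ord0 i)).
  have Lr : rz + e *: delta_mx ord0 i @[e --> 0^'+] --> rz by exact: cvg_within_filter L.
  exact: (Lr _ near_z).
near ((0 : R)^'+) => e.
have e0 : 0 < e by near: e; exact: nbhs_right_gt.
have ez : e < 1 - tnth z i by near: e; apply: nbhs_right_lt; rewrite subr_gt0.
pose w := tuple_of_row (rz + e *: delta_mx ord0 i).
have wE j : tnth w j = tnth z j + (if j == i then e else 0).
  rewrite tnth_mktuple !mxE eqxx/=; congr (_ + _).
  by case: (j =P i) => _; rewrite ?mulr1 ?mulr0.
have wI : unit_cube d w.
  move=> j; rewrite wE; have /andP[zj0 zj1] := zI j.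
  by case: (j =P i) => [ji|_]; rewrite ?addr0 ?zj0// ji in zj0 zj1 *; apply/andP; split; lra.
have [_ wz] : zero_set C w by move: wI; rewrite /w; near: e; exact: L'.
have := zero _ wI wz; rewrite zE leNgt => /negP; apply.
rewrite /sum_pseudoinverse (bigD1 i)//= [ltRHS](bigD1 i)//=.
have -> : (\sum_(j < d | j != i) pseudoinverse psi (tnth w j) =
           \sum_(j < d | j != i) pseudoinverse psi (tnth z j))%E.
  by apply: eq_bigr => j /negbTE ji; rewrite wE ji addr0.
rewrite lteD2rE; last first.
  by apply/sum_fin_numP => j _ _; exact: fin.
have [b [b0 pb ->]] : exists b, [/\ 0 <= b, psi b = tnth w i &
    pseudoinverse psi (tnth w i) = b%:E].
  apply: pseudoinverse_exists => //; rewrite wE eqxx.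
  by have /andP[zi0 _] := zI i; apply/andP; split; lra.
rewrite ltNge -generator_le// pb wE eqxx -ltNge; lra.
Unshelve. all: by end_near. Qed.

Section restricted_image.
Context d1 d2 (Y : measurableType d1) (Z : measurableType d2) (R : realType).
Variables (m1 : {measure set Y -> \bar R}) (m2 : {measure set Z -> \bar R}).
Variables (E : set Y) (h : Y -> Z).
Hypotheses (mE : measurable E) (mh : measurable_fun [set: Y] h).
Hypothesis m2E : forall f, (forall z, 0 <= f z)%E -> measurable_fun [set: Z] f ->
  (\int[m2]_z f z = \int[m1]_(y in E) f (h y))%E.

Lemma restricted_image_integral U f : measurable U -> (forall z, 0 <= f z)%E ->
  measurable_fun [set: Z] f ->
  (\int[m2]_(z in U) f z = \int[m1]_(y in E `&` (h @^-1` U)) f (h y))%E.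
Proof.
move=> mU f0 mf; rewrite integral_mkcond m2E; last 2 first.
- by move=> z; rewrite patchE; case: ifP.
- by apply/(measurable_restrictT _ mU); exact: measurable_funTS.
rewrite integral_mkcondr; apply: eq_integral => y _; rewrite !patchE.
by congr (if _ then _ else _); apply/idP/idP; rewrite !inE.
Qed.

Lemma restricted_image_measure U : measurable U -> m2 U = m1 (E `&` (h @^-1` U)).
Proof.
move=> mU; have := @restricted_image_integral U (cst 1%E) mU (fun=> lee01).
have mhU : measurable (E `&` (h @^-1` U)).
  by apply: measurableI => //; rewrite -[_ @^-1` _]setTI; exact: mh.
rewrite !integral_cst// !mul1e; apply; exact: measurable_cst.
Qed.

End restricted_image.

(** * Assembly of the Markov kernel and the marginal measure *)

Section archimedean_markov_kernel.
Variables (R : realType) (d l : nat) (psi : R -> R) (C : d.-tuple R -> R).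
Hypotheses (hd : (2 <= d)%N) (hl : (1 <= l <= d.-1)%N).
Hypothesis hC : is_archimedean psi C.
Local Notation phi := (pseudoinverse psi).
Local Notation G := (iterated_slope psi).
Local Notation sigma x := (sum_real_pseudoinverse psi x).
Local Notation good := (regular_tuple psi).

Let psi_gen : is_generator psi. Proof. by case: hC. Qed.
Let psi_mono : mono d psi. Proof. exact: archimedean_mono hC. Qed.
Let psi0 := generator_cvg0 psi_gen.
Let ld : (l < d)%N. Proof. by case: d hd hl => // d' _ /andP[]. Qed.
Let l0 : (0 < l)%N. Proof. by case/andP: hl. Qed.
Let dl0 : (0 < d - l)%N. Proof. by rewrite subn_gt0. Qed.

Let ones n : n.-tuple R := [tuple 1 | _ < n].
Let zeros n : n.-tuple R := [tuple 0 | _ < n].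

Let unit_cube_ones n : unit_cube n (ones n).
Proof. by move=> i; rewrite tnth_mktuple ler01 lexx. Qed.

Let sum_ones n : sum_pseudoinverse psi (ones n) = 0%E.
Proof.
by rewrite /sum_pseudoinverse big1// => i _; rewrite tnth_mktuple pseudoinverse1.
Qed.

Let marginE (x : l.-tuple R) : unit_cube l x ->
  margin C x = ext psi (sum_pseudoinverse psi x).
Proof.
move=> xI; have [_ _ _ CE] := hC.
have -> : margin C x = C (join x (ones (d - l))).
  rewrite /margin; congr (C (join x _)); apply: eq_from_tnth => i.
  by rewrite tnth_mktuple tnth_nseq.
rewrite CE; last by apply: unit_cube_join => //; exact: ltnW.
by rewrite sum_pseudoinverse_join ?sum_ones ?adde0// ltnW.
Qed.

Let good_min (x : l.-tuple R) : unit_cube l x -> 0 < min_coord x < 1 ->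
  ~ zero_set (margin C) x -> good x.
Proof.
move=> xI /andP[x0 x1] nz.
have x01 i : 0 < tnth x i <= 1.
  by rewrite (min_coord_gt0 i x0)/=; have /andP[] := xI i.
split=> //; split.
  have [i xi] := min_coord_lt1 x1.
  rewrite /sum_real_pseudoinverse (bigD1 i)//= ltr_pwDl//; last first.
    by apply: sumr_ge0 => j _; exact: real_pseudoinverse_ge0.
  rewrite -lte_fin -real_pseudoinverseE// ltNge -(generator_le psi_gen (lexx 0)) ?xI//.
  by rewrite generator0// -ltNge.
rewrite ltNge; apply/negP => zs; apply: nz; split=> //.
by rewrite marginE// ext_eq0// sum_pseudoinverse_fin.
Qed.

Let not_good (x : l.-tuple R) : unit_cube l x ->
  min_coord x = 1 \/ zero_set (margin C) x -> ~ good x.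
Proof.
move=> xI + [x01 [s0 sz]] => -[x1|[_]].
  move: s0; rewrite -lte_fin -(sum_pseudoinverse_fin psi_gen)//.
  rewrite /sum_pseudoinverse big1 ?ltxx// => i _.
  by rewrite (min_coord_eq1 xI x1) pseudoinverse1.
rewrite marginE// sum_pseudoinverse_fin//= => s00.
by move: sz; rewrite -generator_gt0 ?ltW// s00 ltxx.
Qed.

Let zerosP n : nonneg_tuple (zeros n) /\ upper_box (zeros n) = @nonneg_tuple R n.
Proof.
split; first by move=> i; rewrite tnth_mktuple.
by apply/seteqP; split => z h i; have := h i; rewrite tnth_mktuple.
Qed.

Let tsum_zeros n : tsum (zeros n) = 0.
Proof. by rewrite /tsum big1// => i _; rewrite tnth_mktuple. Qed.

Let measurable_nonneg n : measurable (@nonneg_tuple R n).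
Proof. by have [_ <-] := zerosP n; exact: measurable_upper_box. Qed.

Let measurable_box0 n (x : n.-tuple R) : measurable (box0 x).
Proof.
apply: (@measurable_forall_tuple R n (fun i => [set u | 0 <= u <= tnth x i])) => i.
have -> : [set u | 0 <= u <= tnth x i] = `[0, tnth x i]%classic.
  by apply/seteqP; split => u /=; rewrite in_itv.
exact: measurable_itv.
Qed.

Let radial_integral1 n (k : R.-sfker R ~> n.-tuple R) s a :
  radial_integral k (cst 1) s a = k s (upper_box a).
Proof.
rewrite /radial_integral -[RHS]mul1e -integral_cst//.
exact: measurable_upper_box.
Qed.

(** The unnormalized kernel restricts [M] at the sum of [x] to the orthant and pushes it forward by
    psi. Its total mass is [G l] of that sum, so normalization produces the denominator. *)
Let markov_kernel_exists : exists K : R.-pker (l.-tuple R) ~> ((d - l).-tuple R),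
  (forall x y, unit_cube (d - l) y -> ~ good x -> K x (box0 y) = 1%E) /\
  (forall x y, unit_cube (d - l) y -> good x ->
    K x (box0 y) = (ext (G l) ((sigma x)%:E + sum_pseudoinverse psi y)%E /
                    G l (sigma x))%:E).
Proof.
have [M ME] := conditional_kernel psi_gen psi_mono hd (subnKC (ltnW ld)) dl0.
have [M' M'E] := kernel_map_restrict M (@measurable_nonneg (d - l))
  (measurable_push_psi psi_gen (n := d - l)).
have [k kE] := kernel_comap_restrict M' (measurable_regular_tuple psi_gen (n := l))
  (measurable_sum_real_pseudoinverse psi_gen (n := l)).
have kgood x U : measurable U -> good x ->
    k x U = M (sigma x) (@nonneg_tuple R (d - l) `&` (push_psi psi (n := d - l) @^-1` U)).
  move=> mU gx; apply: restricted_image_measure => //.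
  - exact: measurable_nonneg.
  - exact: measurable_push_psi.
  - by move=> f f0 mf; rewrite kE// mem_set// M'E.
have kbad x : ~ good x -> k x setT = 0%E.
  move=> gx; rewrite -[LHS]mul1e -integral_cst// kE//=.
  by rewrite memNset.
have Gpos (x : l.-tuple R) : good x -> 0 < G l (sigma x).
  move=> [_ [s0 sz]]; apply: (iterated_slope_gt0 psi_mono) => //.
  by rewrite (generator_gt0 psi_gen)// ltW.
have kT x : good x -> k x setT = (G l (sigma x))%:E.
  move=> gx; rewrite kgood// preimage_setT setIT.
  have [z0 <-] := zerosP (d - l); rewrite -radial_integral1 ME//.
    by rewrite tsum_zeros addr0.
  by case: gx => _ [].
have kbox x y : unit_cube (d - l) y -> good x ->
    k x (box0 y) = (ext (G l) ((sigma x)%:E + sum_pseudoinverse psi y)%E)%:E.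
  move=> yI gx; rewrite kgood//; last exact: measurable_box0.
  have [[b [b0 -> ->]]|[-> ->]] := push_psi_box psi_gen yI.
    by rewrite -radial_integral1 ME//; case: gx => _ [].
  by rewrite measure0 addey.
(* k vanishes at irregular x, where normalization falls back on P0. *)
pose P0 : probability ((d - l).-tuple R) R := dirac (zeros (d - l)).
exists (knormalize k P0 : R.-pker (l.-tuple R) ~> ((d - l).-tuple R)).
split => x y yI gx.
(* The Dirac mass at the origin lies in every [box0 y], which yields the value 1. *)
- rewrite /knormalize/= /mnormalize kbad// eqxx/= diracE mem_set//.
  by move=> i; rewrite !tnth_mktuple lexx/=; have /andP[] := yI i.
- have := Gpos _ gx => G0.
  rewrite /knormalize/= /mnormalize kT// eqe gt_eqF//= kbox//.
Qed.

(** The measure is the pushforward by psi of the marginal kernel started at sum 0. Integrals over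
    boxes are computed in the [z] coordinates, so that the integrand has to be known only on the
    image of [push_psi]. *)
Let marginal_measure_exists : exists mu : probability (l.-tuple R) R,
  forall x (f : l.-tuple R -> \bar R) (F : R -> R) (T : \bar R), unit_cube l x ->
    (forall s, 0 <= f s)%E -> measurable_fun [set: l.-tuple R] f ->
    measurable_fun [set: R] F -> (forall u, 0 <= F u) -> (0 <= T)%E ->
    (forall u : R, 0 < u -> (u%:E < phi 0)%E ->
      F u * G l u = ext (G l) (u%:E + T)%E) ->
    (forall z, nonneg_tuple z -> f (push_psi psi z) = (F (tsum z))%:E) ->
    (\int[mu]_(s in box0 x) f s =
      (ext psi (sum_pseudoinverse psi x + T)%E)%:E)%E.
Proof.
have l0d : (0 < l < d)%N by rewrite l0 ld.
have [N NE] := marginal_kernel psi_gen psi_mono l0d.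
have [N' N'E] := kernel_map_restrict N (@measurable_nonneg l)
  (measurable_push_psi psi_gen (n := l)).
have N'T : N' 0 setT = 1%E.
  have -> : N' 0 setT = N 0 (@nonneg_tuple R l `&` (push_psi psi (n := l) @^-1` setT)).
    apply: restricted_image_measure => //.
    - exact: measurable_nonneg.
    - exact: measurable_push_psi.
    - exact: N'E.
  rewrite preimage_setT setIT; have [z0 <-] := zerosP l.
  rewrite -radial_integral1 (NE (cst 1) 0%E)//.
  - by rewrite tsum_zeros adde0/= generator0.
  - by move=> u u0 _; rewrite adde0 mul1r.
(* The total mass is already [psi 0 = 1]; [mnormalize] changes no value and only supplies the
   probability structure. *)
pose mu : probability (l.-tuple R) R :=
  mnormalize (N' 0) (dirac (zeros l) : probability (l.-tuple R) R).
have muE U : mu U = N' 0 U.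
  by rewrite /mu/= /mnormalize N'T onee_eq0/= invr1 mule1.
exists mu => x f F T xI f0 mf mF F0 T0 FG fF.
rewrite (@eq_measure_integral _ _ _ _ (N' 0)); last by move=> A _ _; exact: muE.
transitivity (\int[N 0%R]_(z in @nonneg_tuple R l `&`
    (push_psi psi (n := l) @^-1` box0 x)) f (push_psi psi z))%E.
  apply: restricted_image_integral => //.
  - exact: N'E.
  - exact: measurable_box0.
have [[b [b0 -> ->]]|[-> ->]] := push_psi_box psi_gen xI.
  rewrite -(NE F T)// /radial_integral; apply: eq_integral => z; rewrite inE => bz.
  rewrite add0r fF// => i; apply: le_trans (bz i); exact: b0.
by rewrite integral_set0 addye ?gt_eqF// (lt_le_trans (ltNy0)).
Qed.

Lemma archimedean_markov_kernel :
  exists K : R.-pker (l.-tuple R) ~> ((d - l).-tuple R),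
    (forall (x : l.-tuple R) (y : (d - l).-tuple R),
      unit_cube l x -> unit_cube (d - l) y ->
      [/\ min_coord x = 1 \/ zero_set (margin C) x ->
            K x (box0 y) = 1%E,
          0 < min_coord x < 1 -> ~ zero_set (margin C) x ->
          cube_interior (zero_set C) (join x y) ->
            K x (box0 y) = 0%E &
          0 < min_coord x < 1 -> ~ zero_set (margin C) x ->
          ~ cube_interior (zero_set C) (join x y) ->
            K x (box0 y) =
            (generator_derivative d l psi
               (sum_pseudoinverse psi x + sum_pseudoinverse psi y)%E
             / generator_derivative d l psi (sum_pseudoinverse psi x))%:E]) /\
    is_markov_kernel C K.
Proof.
have [K [Kbad Kgood]] := markov_kernel_exists.
have [mu muE] := marginal_measure_exists.
exists K; split=> [x y xI yI|].
  split=> [xb|x01 nz xyi|x01 nz _]; first by apply: Kbad => //; exact: not_good.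
    have gx := good_min xI x01 nz; have [x01' [s0 sz]] := gx.
    rewrite Kgood//; have := cube_interior_zero_set hC xyi.
    rewrite sum_pseudoinverse_join; last exact: ltnW.
    rewrite (sum_pseudoinverse_fin psi_gen x01').
    have := sum_pseudoinverse_ge0 psi y.
    case: (sum_pseudoinverse psi y) => [t| |]// t0 h; last first.
      by rewrite addey//= mul0r.
    case: h => [h|//]; rewrite -EFinD in h.
    have zF : phi 0 = (fine (phi 0))%:E.
      rewrite fineK// ge0_fin_numE ?pseudoinverse_ge0//.
      by rewrite (lt_trans h)// ltry.
    rewrite /= (@iterated_slope_eq0 R d psi psi_mono psi0 l (fine (phi 0))) ?mul0r//.
    - exact/fine_ge0/pseudoinverse_ge0.
    - move=> u zu; apply/eqP; rewrite generator_eq0//.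
        by rewrite zF lee_fin ltW.
      by apply: le_trans (ltW zu); exact/fine_ge0/pseudoinverse_ge0.
    - by rewrite -lte_fin -zF.
  have gx := good_min xI x01 nz; have [x01' [s0 sz]] := gx.
  rewrite Kgood// (sum_pseudoinverse_fin psi_gen x01'); congr (_%:E).
  have ld' : (1 <= l < d)%N by rewrite l0 ld.
  rewrite (generator_derivative_iterated_slope psi_mono psi0 ld' s0).
  have := sum_pseudoinverse_ge0 psi y.
  case: (sum_pseudoinverse psi y) => [t| |]// t0; last by rewrite addey//= !mul0r.
  rewrite -EFinD (generator_derivative_iterated_slope psi_mono psi0 ld')//; last first.
    by rewrite lee_fin in t0; lra.
  (* Numerator and denominator carry the same sign [(-1)^l], which cancels. *)
  by rewrite -mulf_div divff ?mul1r// expf_neq0// oppr_eq0 oner_eq0.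
have Kcube x : K x (unit_cube (d - l)) = 1%E.
  have -> : unit_cube (d - l) = box0 (ones (d - l)).
    by apply/seteqP; split => z h i; have := h i; rewrite tnth_mktuple.
  have [gx|gx] := pselect (good x); last exact: Kbad.
  rewrite Kgood// sum_ones adde0/= divff// gt_eqF//.
  case: gx => _ [s0 sz]; apply: (iterated_slope_gt0 psi_mono) => //.
  by rewrite (generator_gt0 psi_gen)// ltW.
split; first by move=> x _; exact: Kcube.
have m1 : measurable_fun [set: R] (cst (1 : R)) by exact: measurable_cst.
exists mu.
  move=> x xI.
  have <- : (\int[mu]_(s in box0 x) cst 1%E s = mu (box0 x))%E.
    by rewrite integral_cst ?mul1e//; exact: measurable_box0.
  rewrite (muE x (cst 1%E) (cst 1) 0%E)//; first by rewrite adde0 marginE.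
  by move=> u u0 _; rewrite adde0 mul1r.
move=> x y xI yI.
set T := sum_pseudoinverse psi y.
have T0 : (0 <= T)%E by exact: sum_pseudoinverse_ge0.
(* This is the value of the kernel on [box0 y] as a function of the sum of [z]; the default 1
   matches the kernel at irregular points. *)
pose F u := if (0 < u) && (u%:E < phi 0)%E then ext (G l) (u%:E + T)%E / G l u else 1.
have Gu (u : R) : 0 < u -> (u%:E < phi 0)%E -> 0 < G l u.
  move=> u0 uz; apply: (iterated_slope_gt0 psi_mono) => //.
  by rewrite (generator_gt0 psi_gen)// ltW.
have extG (u : R) : 0 < u -> 0 <= ext (G l) (u%:E + T)%E.
  move: T0; case: (T) => [t| |]//= t0 u0.
  by apply: (iterated_slope_ge0 psi_mono) => //; rewrite lee_fin in t0; lra.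
have [_ _ _ CE] := hC.
rewrite CE; last by apply: unit_cube_join => //; exact: ltnW.
rewrite sum_pseudoinverse_join; last exact: ltnW.
apply: (muE _ _ F) => //.
- by apply: measurable_kernel; exact: measurable_box0.
- apply: measurable_if_lt_ereal; apply: measurable_funM.
    apply: nonincreasing_itv_measurable; first exact: is_interval_lt_ereal.
    move=> s t [s0 _] _ st.
    move: T0; case: (T) => [r| |]//= r0; rewrite lee_fin in r0.
    by apply: (iterated_slope_nincr psi_mono) => //; lra.
  (* The reciprocal of [G l] is nondecreasing; negating it allows the measurability lemma for
     nonincreasing functions. *)
  rewrite (_ : (fun u => (G l u)^-1) = \- (fun u => - (G l u)^-1)); last first.
    by apply/funext => u /=; rewrite opprK.
  apply: measurable_funN.
  apply: nonincreasing_itv_measurable; first exact: is_interval_lt_ereal.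
  move=> s t [s0 sz] [t0 tz] st.
  rewrite lerN2 lef_pV2 ?posrE ?Gu//.
  exact: (iterated_slope_nincr psi_mono).
- move=> u; rewrite /F; case: ifP => // /andP[u0 uz].
  by rewrite divr_ge0 ?extG// ltW// Gu.
- by move=> u u0 uz; rewrite /F u0 uz/= divfK// gt_eqF// Gu.
- move=> z z0; have [gz|gz] := pselect (good (push_psi psi z)).
    rewrite Kgood//; have [z1 zz] := (good_push_psi psi_gen z0).1 gz.
    rewrite /F z1 zz/= push_psi_sum// => i; case: gz => /(_ i) /andP[]//.
  rewrite Kbad// /F ifF//; apply/negbTE/negP => /andP[z1 zz].
  by apply: gz; apply/(good_push_psi psi_gen z0).
Qed.

End archimedean_markov_kernel.

Theorem theorem3p1 (R : realType) (d l : nat) (psi : R -> R)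
    (C : d.-tuple R -> R) (hd : (2 <= d)%N) (hl : (1 <= l <= d.-1)%N)
    (hC : is_archimedean psi C) :
  exists K : R.-pker (l.-tuple R) ~> ((d - l).-tuple R),
    (forall (x : l.-tuple R) (y : (d - l).-tuple R),
      unit_cube l x -> unit_cube (d - l) y ->
      [/\ min_coord x = 1 \/ zero_set (margin C) x ->
            K x (box0 y) = 1%E,
          0 < min_coord x < 1 -> ~ zero_set (margin C) x ->
          cube_interior (zero_set C) (join x y) ->
            K x (box0 y) = 0%E &
          0 < min_coord x < 1 -> ~ zero_set (margin C) x ->
          ~ cube_interior (zero_set C) (join x y) ->
            K x (box0 y) =
            (generator_derivative d l psi
               (sum_pseudoinverse psi x + sum_pseudoinverse psi y)%E
             / generator_derivative d l psi (sum_pseudoinverse psi x))%:E]) /\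
    is_markov_kernel C K.
Proof. exact: archimedean_markov_kernel. Qed.
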